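(* Suppose that $Y\to X\to X/Y$ is a short exact sequence of Banach spaces, $X$ has the approximation property, and $Y$ is a $\mathcal{L}_\infty$ space. Then the pair $(X,Y)$ has the approximation property and hence $X/Y$ has the approximation property.
   Context: $L(X)$ is the space of bounded linear operators on the Banach space $X$, and $\tau$ is the topology on $L(X)$ of uniform convergence on compact subsets of $X$. Subspaces are closed. A Banach space $X$ has the approximation property (AP) if the identity on $X$ is the $\tau$-limit of a net of finite rank bounded linear operators on $X$. For a subspace $Y$ of $X$, the pair $(X,Y)$ has the approximation property (AP) if the identity on $X$ is the $\tau$-limit of a net of finite rank bounded linear operators on $X$ all of which leave $Y$ invariant. A sequence $Y\to X\to Z$ of Banach spaces is a short exact sequence when the operator $Y\to X$ is an isomorphic embedding and the operator $X\to Z$ is surjective and has (the image of) $Y$ as its kernel. Up to passing to equivalent norms, this just says that $Y$ is a subspace of $X$ and $Z$ is the quotient space $X/Y$; $Y$ is regarded as a subspace of $X$ via the embedding. A Banach space $Y$ is $\mathcal{L}_\infty$ if there is $\lambda<\infty$ such that every finite dimensional subspace of $Y$ is contained in a finite dimensional subspace $F$ of $Y$ whose Banach–Mazur distance to $\ell_\infty^{\dim F}$ is at most $\lambda$. *)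

(* Defs.v *)
From HB Require Import structures.
From mathcomp Require Export all_boot all_order all_algebra.
From mathcomp Require Export all_classical all_reals all_analysis.
From mathcomp Require Export complex.
Export Order.TTheory GRing.Theory Num.Theory.
Export numFieldNormedType.Exports.

Set Implicit Arguments.
Unset Strict Implicit.
Unset Printing Implicit Defensive.

Local Open Scope classical_set_scope.
Local Open Scope ring_scope.
Local Open Scope complex_scope.

(* Banach spaces are real or complex. A [completeNormedModType K] has its norm
   valued in [K] itself; over [R[i]] norms are complex numbers that are real
   and nonnegative, and [x <= y] means that [y - x] is such a number. *)
Variant scalar_field (R : realType) : numFieldType -> Prop :=
  | RealScalars : scalar_field R R
  | ComplexScalars : scalar_field R R[i].

Section FiniteDimension.
Context {K : numFieldType} {V : normedModType K}.

Definition lin_indep n (v : 'I_n -> V) : Prop :=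
  forall a : 'I_n -> K, \sum_i a i *: v i = 0 -> forall i, a i = 0.

Definition lin_span n (v : 'I_n -> V) : set V :=
  [set x | exists a : 'I_n -> K, x = \sum_i a i *: v i].

Definition subspace_of_dim (n : nat) (E : set V) : Prop :=
  exists v : 'I_n -> V, lin_indep v /\ E = lin_span v.

Definition finite_dim_subspace (E : set V) : Prop :=
  exists n, subspace_of_dim n E.

End FiniteDimension.

Section BoundedOperators.
Context {K : numFieldType}.
Implicit Types V W : normedModType K.

Definition bounded_on V W (E : set V) (f : V -> W) : Prop :=
  exists M : K, forall x, E x -> `|f x| <= M * `|x|.

Definition bounded_op V W (f : V -> W) : Prop := bounded_on setT f.

(* Operator norm of the restriction of [f] to the subspace [E]. *)
Definition opnorm_on V W (E : set V) (f : V -> W) : K :=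
  supremum 0 [set `|f x| | x in E `&` [set x | `|x| <= 1]].

Definition finite_rank V W (f : V -> W) : Prop :=
  finite_dim_subspace (range f).

Definition isomorphic_embedding V W (f : {linear V -> W}) : Prop :=
  bounded_op f /\ exists2 c : K, 0 < c & forall x, c * `|x| <= `|f x|.

Definition short_exact_sequence (Y X Z : normedModType K)
    (j : {linear Y -> X}) (q : {linear X -> Z}) : Prop :=
  [/\ isomorphic_embedding j, bounded_op q, range q = setT &
      range j = [set x | q x = 0]].

End BoundedOperators.

Section ApproximationProperty.
Context {K : numFieldType}.

Definition directed (I : Type) (le : I -> I -> Prop) : Prop :=
  [/\ inhabited I, (forall i, le i i),
      (forall i j k, le i j -> le j k -> le i k) &
      (forall i j, exists k, le i k /\ le j k)].

Definition tails (I : Type) (le : I -> I -> Prop) : set_system I :=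
  [set A | exists i0, forall i, le i0 i -> A i].

(* The identity is the limit, uniformly on compact sets, of a net in [P]. *)
Definition id_tau_limit (X : normedModType K) (P : set {linear X -> X}) : Prop :=
  exists (I : Type) (le : I -> I -> Prop) (T : I -> {linear X -> X}),
    [/\ directed le, (forall i, P (T i)) &
        {family compact, ((fun i => T i : X -> X) @ tails le) --> (id : X -> X)}].

Definition AP (X : normedModType K) : Prop :=
  id_tau_limit [set T : {linear X -> X} | bounded_op T /\ finite_rank T].

Definition pair_AP (X : normedModType K) (Y : set X) : Prop :=
  id_tau_limit [set T : {linear X -> X} |
    [/\ bounded_op T, finite_rank T & T @` Y `<=` Y]].

End ApproximationProperty.

Section LInfinity.
Context {K : numFieldType}.

(* Banach-Mazur distance between the space [U] and the subspace [F] of [V].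
   An isomorphism from [U] onto [F] is given by [S : U -> V] with range [F];
   its inverse is the restriction to [F] of [T : V -> U], whose values outside
   [F] play no role. *)
Definition banach_mazur (U V : normedModType K) (F : set V) : K :=
  infimum 0 [set d | exists (S : {linear U -> V}) (T : V -> U),
    [/\ bounded_op S, range S = F, cancel S T, bounded_on F T &
        d = opnorm_on setT S * opnorm_on F T]].

(* The norm of ['rV[K]_n] is the sup norm, so that ['rV[K]_n] is the
   n-dimensional l_infinity space. Since [F] has dimension [n], the set in
   [banach_mazur] is nonempty and its infimum is a genuine one. *)
Definition Linfty_space (Y : normedModType K) : Prop :=
  exists lambda : K, forall E : set Y, finite_dim_subspace E ->
    exists (n : nat) (F : set Y),
      [/\ subspace_of_dim n F, E `<=` F & banach_mazur 'rV[K]_n F <= lambda].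

End LInfinity.

(* Main.v *)
(* Let w : Y -> Y have finite rank. When w is small on a neighbourhood of Y \cap C, with
   C absolutely convex and totally bounded in X, the gauge of C plus a large multiple of
   the norm dominates w, so Hahn-Banach applied to the coordinates of a copy of
   l_infinity^n containing w Y extends w to an operator X -> Y that is small on C. Take
   finite rank w_m -> id on Y \cap C so fast that the extensions of the increments
   w_(m+1) - w_m sum up to finite rank D_m : X -> Y with D_m = w_m on Y and with all the
   sets D_m C inside one totally bounded set. Only then choose S of finite rank close to
   the identity on all (I - D_m) C, and finally m such that S (I - w_m) is small near
   Y \cap C, hence extends to some V small on C. The operator
   T = D_m + S (I - D_m) - V equals w_m on Y and I - T = (I - S) (I - D_m) + V. *)

(* The order of the choices is forced. An S supplied by the approximation property of X need not
   leave Y invariant; V is there to cancel S (I - w_m) on Y. The price of extending that map is the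
   distance from the range of S to some l_infinity^k, over which there is no control, so m has to
   come after S. Then S must be good on (I - D_m) C for all m at once, and this asks for one totally
   bounded set containing them all. Here the structure of Y enters: finite rank maps into Y extend
   with a loss [lam] that depends on Y alone, so the increments keep their geometric rate after
   extension. Smallness on Y \cap C alone would not let the gauge dominate w, because a point of Y
   can be close to a multiple of C without belonging to it; hence the neighbourhoods, called
   [thickening]. For the quotient, an operator leaving Y invariant induces one on X/Y. The lifting
   of points to X is bounded but not linear, so it is applied only to sets whose points tend to 0;
   by [tb_null_set] such sets control all totally bounded ones. *)
From HB Require Import structures.
Require Import Defs.
From mathcomp Require Import ring lra.
Set Implicit Arguments.
Unset Strict Implicit.
Unset Printing Implicit Defensive.
Local Open Scope classical_set_scope.
Local Open Scope ring_scope.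

(* A common interface to the scalars [R] and [R[i]]: [im_unit] is [0] in the real case. *)
Record scalars (R : realType) (K : numFieldType) := Scalars {
  iota : {rmorphism R -> K};
  re : K -> R;
  im_unit : K;
  reD : forall a b, re (a + b) = re a + re b;
  reM : forall a b, re (iota a * b) = a * re b;
  re1 : re 1 = 1;
  re_im_unit : re im_unit = 0;
  re_norm : forall a : K, iota (re `|a|) = `|a|;
  le_re_norm : forall a : K, re a <= re `|a|;
  iota_le : forall a b, (iota a <= iota b) = (a <= b);
  im_unit_cases : im_unit = 0 \/ im_unit * im_unit = -1;
  re_decomp : forall a : K, a = iota (re a) - iota (re (im_unit * a)) * im_unit
}.

Lemma scalar_fieldP (R : realType) (K : numFieldType) :
  scalar_field R K -> inhabited (scalars R K).
Proof.
case.
- apply: inhabits.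
  apply: (@Scalars R R idfun id 0) => //.
  + by move=> a; exact: ler_norm.
  + by left.
  + by move=> a /=; rewrite mulr0 subr0.
- apply: inhabits.
  apply: (@Scalars R R[i] (real_complex R) (@complex.Re R) (Complex 0 1)) => //.
  + by move=> [a b] [c d].
  + by move=> a [c d] /=; rewrite mul0r subr0.
  + move=> [a b]; rewrite normc_def /=.
    by rewrite (le_trans (ler_norm _)) // -sqrtr_sqr ler_wsqrtr // lerDl sqr_ge0.
  + by move=> a b; rewrite lecR.
  + by right; apply/eqP; rewrite eq_complex /=; apply/andP; split; apply/eqP; ring.
  + by move=> [a b]; apply/eqP; rewrite eq_complex /=; apply/andP; split; apply/eqP; ring.
Qed.

Lemma linear_pack (K : pzRingType) (U V : lmodType K) (f : U -> V) :
  linear f -> exists F : {linear U -> V}, forall x, F x = f x.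
Proof.
move=> lf.
pose fL := GRing.isLinear.Build K U V *:%R f lf.
pose F : {linear U -> V} := HB.pack f fL.
by exists F.
Qed.

(** * Real-valued norms over either scalar field *)

Section RealNorm.
Context {R : realType} {K : numFieldType} (s : scalars R K).
Implicit Types V W : normedModType K.
Local Notation iota := (iota s).
Local Notation re := (re s).

(** Over [R[i]] norms live in a partially ordered field. Their real parts give access to [sup],
    [inf] and real arithmetic, and [iota] recovers the norms. *)
Definition rabs (a : K) : R := re `|a|.
Definition rnorm V (v : V) : R := re `|v|.

Lemma re_iota a : re (iota a) = a.
Proof. by rewrite -[iota a]mulr1 reM re1 mulr1. Qed.

Lemma iota_inj : injective iota.
Proof. exact: can_inj re_iota. Qed.

Lemma reE a : 0 <= a -> iota (re a) = a.
Proof. by move=> a0; rewrite -[in LHS](ger0_norm a0) re_norm ger0_norm. Qed.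

Lemma iota_lt a b : (iota a < iota b) = (a < b).
Proof. by rewrite !lt_neqAle iota_le (inj_eq iota_inj). Qed.

Lemma iota_ge0 a : (0 <= iota a) = (0 <= a).
Proof. by rewrite -(rmorph0 iota) iota_le. Qed.

Lemma iota_gt0 a : (0 < iota a) = (0 < a).
Proof. by rewrite -(rmorph0 iota) iota_lt. Qed.

Lemma re_le a b : 0 <= a -> a <= b -> re a <= re b.
Proof. by move=> a0 ab; rewrite -(iota_le s) !reE // (le_trans a0). Qed.

Lemma re0 : re 0 = 0.
Proof. by rewrite -(rmorph0 iota) re_iota. Qed.

Lemma re_ge0 a : 0 <= a -> 0 <= re a.
Proof. by move=> a0; rewrite -(re0) re_le. Qed.

Lemma re_gt0 a : 0 < a -> 0 < re a.
Proof. by move=> a0; rewrite -(iota_gt0) reE // ltW. Qed.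

Lemma rnormE V (v : V) : `|v| = iota (rnorm v).
Proof. by rewrite reE. Qed.

Lemma rabsE a : `|a| = iota (rabs a).
Proof. by rewrite reE. Qed.

Lemma rnorm_le V (v : V) a : (rnorm v <= a) = (`|v| <= iota a).
Proof. by rewrite rnormE iota_le. Qed.

Lemma rnorm_ge0 V (v : V) : 0 <= rnorm v.
Proof. exact: re_ge0. Qed.

Lemma rabs_ge0 a : 0 <= rabs a.
Proof. exact: re_ge0. Qed.

Lemma rnormD V (v w : V) : rnorm (v + w) <= rnorm v + rnorm w.
Proof. by rewrite -(iota_le s) rmorphD /= -!rnormE ler_normD. Qed.

Lemma rnormN V (v : V) : rnorm (- v) = rnorm v.
Proof. by rewrite /rnorm normrN. Qed.

Lemma rnorm_sub V (v w : V) : rnorm (v - w) = rnorm (w - v).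
Proof. by rewrite -rnormN opprB. Qed.

Lemma rnormZ V a (v : V) : rnorm (a *: v) = rabs a * rnorm v.
Proof. by apply: iota_inj; rewrite rmorphM /= -rnormE -rabsE -rnormE normrZ. Qed.

Lemma rnorm0 V : rnorm (0 : V) = 0.
Proof. by rewrite /rnorm normr0 re0. Qed.

Lemma rnorm_eq0 V (v : V) : rnorm v <= 0 -> v = 0.
Proof. by rewrite rnorm_le rmorph0 normr_le0 => /eqP. Qed.

Lemma rabsM a b : rabs (a * b) = rabs a * rabs b.
Proof. by apply: iota_inj; rewrite rmorphM /= -!rabsE normrM. Qed.

Lemma rabsD a b : rabs (a + b) <= rabs a + rabs b.
Proof. by rewrite -(iota_le s) rmorphD /= -!rabsE ler_normD. Qed.

Lemma rabs0 : rabs 0 = 0.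
Proof. by rewrite /rabs normr0 re0. Qed.

Lemma rabs1 : rabs 1 = 1.
Proof. by rewrite /rabs normr1 re1. Qed.

Lemma rabsN1 : rabs (-1) = 1.
Proof. by rewrite /rabs normrN1 re1. Qed.

Lemma rabs_eq0 a : rabs a <= 0 -> a = 0.
Proof. by rewrite -(iota_le s) rmorph0 -rabsE normr_le0 => /eqP. Qed.

Lemma rabs_iota a : rabs (iota a) = `|a|.
Proof.
have h b : 0 <= b -> rabs (iota b) = b.
  by move=> b0; rewrite /rabs ger0_norm ?re_iota // iota_ge0.
have [a0|a0] := leP 0 a; first by rewrite h // ger0_norm.
rewrite -[in LHS](opprK a) rmorphN -mulN1r rabsM rabsN1 mul1r h ?ltr0_norm //.
by rewrite oppr_ge0 ltW.
Qed.

Lemma rabs_im_unit : rabs (im_unit s) <= 1.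
Proof.
case: (im_unit_cases s) => [->|JJ]; first by rewrite rabs0.
have : rabs (im_unit s) * rabs (im_unit s) = 1 by rewrite -rabsM JJ rabsN1.
by have := rabs_ge0 (im_unit s); nra.
Qed.

End RealNorm.

(** * Hahn-Banach extension over real or complex scalars *)

Section HahnBanach.
Context {R : realType} {K : numFieldType} (s : scalars R K) {X : lmodType K}.
Local Notation iota := (iota s).
Local Notation re := (re s).
Local Notation rabs := (rabs s).

(** The inequality for scalars suffices: scaling back by the inverse gives equality, and
    nonnegativity follows from subadditivity at [x] and [- x]. *)
Definition seminorm (p : X -> R) :=
  (forall x y, p (x + y) <= p x + p y) /\
  (forall a x, p (a *: x) <= rabs a * p x).

Lemma seminorm_ge0 p x : seminorm p -> 0 <= p x.
Proof.
move=> [pD pZ].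
have := pD x (-1 *: x); have := pZ (-1) x; have := pZ 0 x; have := pD 0 0.
by rewrite scale0r scaleN1r subrr addr0 rabsN1 rabs0; lra.
Qed.

Lemma seminorm_scale p (t : R) x : seminorm p -> 0 < t ->
  t * p x <= p (iota t *: x).
Proof.
move=> [_ pZ] t0; have := pZ (iota t^-1) (iota t *: x).
rewrite scalerA -rmorphM mulVf ?gt_eqF // rmorph1 scale1r rabs_iota.
by rewrite ger0_norm ?invr_ge0 ?(ltW t0) // ler_pdivlMl.
Qed.

(* Graphs of real-linear functionals, dominated by [p], on real subspaces of [X]. *)
Definition dominated_graph (p : X -> R) (f : set (X * R)) :=
  [/\ f (0, 0),
      forall t x a y b, f (x, a) -> f (y, b) -> f (iota t *: x + y, t * a + b) &
      forall x a, f (x, a) -> a <= p x].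

Lemma dominated_graph_scale p f t x a : dominated_graph p f ->
  f (x, a) -> f (iota t *: x, t * a).
Proof. by move=> [f0 fl _] fx; have := fl t _ _ _ _ fx f0; rewrite !addr0. Qed.

(** Both [a - b] and [b - a] are values over the zero vector, hence at most [p 0 <= 0]: domination
    alone makes the relation single-valued. *)
Lemma dominated_graph_fun p f x a b : seminorm p -> dominated_graph p f ->
  f (x, a) -> f (x, b) -> a = b.
Proof.
move=> hp [_ fl fp] fa fb.
have p0 : p 0 <= 0 by have := hp.2 0 0; rewrite scale0r rabs0 mul0r.
have := fp _ _ (fl (-1) _ _ _ _ fa fb); have := fp _ _ (fl (-1) _ _ _ _ fb fa).
by rewrite rmorphN1 !scaleN1r addNr; lra.
Qed.

(** A value [r] at [x0] preserves domination if [b - p (y - x0) <= r <= p (y + x0) - b] for all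
    [(y, b)] in [f]. By subadditivity every lower bound lies below every upper one, so the supremum
    of the lower ones will do. *)
Lemma dominated_graph_extend p f x0 : seminorm p -> dominated_graph p f ->
  exists2 g, dominated_graph p g & f `<=` g /\ exists r, g (x0, r).
Proof.
move=> hp hf; have [f0 fl fp] := hf.
pose E := [set r | exists y b, f (y, b) /\ r = b - p (y - x0)].
have ubE y b : f (y, b) -> ubound E (p (y + x0) - b).
  move=> fy _ [z [c [fz ->]]].
  have := fp _ _ (fl 1 _ _ _ _ fy fz); rewrite rmorph1 scale1r mul1r.
  by have := hp.1 (y + x0) (z - x0); rewrite addrACA subrr addr0; lra.
have hE : has_sup E.
  split; first by exists (0 - p (0 - x0)), 0, 0.
  by exists (p (0 + x0) - 0); exact: ubE.
pose r := sup E.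
have r_ge y b : f (y, b) -> b - p (y - x0) <= r.
  by move=> fy; apply: ub_le_sup; [exact: hE.2|exists y, b].
have r_le y b : f (y, b) -> r <= p (y + x0) - b.
  by move=> fy; apply: ge_sup; [exact: hE.1|exact: ubE].
pose g := [set z : X * R | exists t y b,
  f (y, b) /\ z = (y + iota t *: x0, b + t * r)].
exists g; last split.
- split.
  + by exists 0, 0, 0; rewrite rmorph0 scale0r mul0r !addr0.
  + move=> t _ _ _ _ [u [y [b [fy [-> ->]]]]] [v [z [c [fz [-> ->]]]]].
    exists (t * u + v), (iota t *: y + z), (t * b + c); split; first exact: fl.
    rewrite rmorphD rmorphM /= scalerDl scalerDr scalerA addrACA.
    by congr pair; ring.
  + move=> _ _ [t [y [b [fy [-> ->]]]]].
    (* Dividing by the absolute value of [t] reduces to coefficient -1 or 1 at [x0], that is, to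
       [r_ge] or [r_le]. *)
    have [t0|t0|->] := ltgtP t 0.
    * have nt0 : 0 < - t by rewrite oppr_gt0.
      have := r_ge _ _ (dominated_graph_scale (- t)^-1 hf fy).
      rewrite -(ler_pM2l nt0) mulrBr mulVKf ?gt_eqF // => h.
      have := seminorm_scale (iota (- t)^-1 *: y - x0) hp nt0.
      rewrite scalerBr scalerA -rmorphM mulfV ?gt_eqF // rmorph1 scale1r rmorphN.
      by rewrite scaleNr opprK; lra.
    * have := r_le _ _ (dominated_graph_scale t^-1 hf fy).
      rewrite -(ler_pM2l t0) mulrBr mulVKf ?gt_eqF // => h.
      have := seminorm_scale (iota t^-1 *: y + x0) hp t0.
      rewrite scalerDr scalerA -rmorphM mulfV ?gt_eqF // rmorph1 scale1r.
      by lra.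
    * by rewrite rmorph0 scale0r mul0r !addr0; exact: fp.
- by move=> [y b] fy; exists 0, y, b; rewrite rmorph0 scale0r mul0r !addr0.
- by exists r, 1, 0, 0; rewrite rmorph1 scale1r mul1r !add0r.
Qed.

Lemma dominated_graph_total p f : seminorm p -> dominated_graph p f ->
  exists2 g, dominated_graph p g & f `<=` g /\ forall x, exists r, g (x, r).
Proof.
move=> hp hf.
pose P := [set A : set (X * R) | A = set0 \/ f `<=` A /\ dominated_graph p A].
have [|A [PA maxA]] := @Zorn_bigcup _ P.
  move=> F FP totF.
  have [FE|/existsNP[A0 /not_implyP[FA0 A0n]]] :=
      pselect (forall A, F A -> A = set0).
    by left; apply/seteqP; split=> // x [A /FE -> //].
  right; have := FP _ FA0 => -[//|[fA0 [A00 _ _]]]; split.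
    by move=> x fx; exists A0 => //; exact: fA0.
  have good A : F A -> A !=set0 -> dominated_graph p A.
    by move=> /FP[->[]|[]].
  split.
  - by exists A0.
  - move=> t x a y b [A FA Ax] [B FB By].
    have [_ lA _] : dominated_graph p A by apply: good => //; exists (x, a).
    have [_ lB _] : dominated_graph p B by apply: good => //; exists (y, b).
    by have [AB|BA] := totF _ _ FA FB; [exists B|exists A] => //; auto.
  - move=> x a [A FA Ax].
    by have [|_ _ ] := good A FA; [exists (x, a)|apply].
have [fA hA] : f `<=` A /\ dominated_graph p A.
  case: PA => // A0; exfalso; apply: (maxA f); last by right; split.
  by rewrite A0; split=> // /(_ (0, 0)); apply; case: hf.
exists A => //; split=> // x.
have [g hg [Ag [r gr]]] := dominated_graph_extend x hp hA.
exists r; apply: contrapT => nA.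
apply: (maxA g); first by split=> // /(_ _ gr).
by right; split=> //; exact: subset_trans Ag.
Qed.

(** The real part of [h] is extended to a real functional [u], and [g x = u x - u (i x) i] is its
    complexification; with [im_unit] equal to 0 this is [u] itself. That [h] factors through [j] is
    a consequence of the domination. *)
Lemma hahn_banach (U : lmodType K) (j : {linear U -> X}) (h : U -> K) p :
  seminorm p -> (forall a u v, h (a *: u + v) = a * h u + h v) ->
  (forall u, rabs (h u) <= p (j u)) ->
  exists g : X -> K,
    [/\ forall a x y, g (a *: x + y) = a * g x + g y,
        forall u, g (j u) = h u & forall x, rabs (g x) <= p x].
Proof.
move=> hp hl hd; set J := im_unit s.
pose f0 := [set z : X * R | exists u, z = (j u, re (h u))].
have hf0 : dominated_graph p f0.
  split.
  - exists 0; rewrite linear0; have := hl (-1) 0 0.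
    by rewrite scaleN1r oppr0 addr0 mulN1r addNr => ->; rewrite re0.
  - move=> t _ _ _ _ [u [-> ->]] [v [-> ->]].
    by exists (iota t *: u + v); rewrite linearP hl reD reM.
  - by move=> _ _ [u [-> ->]]; exact: le_trans (le_re_norm _ _) (hd u).
have [A hA [fA /choice[u uA]]] := dominated_graph_total hp hf0.
have uE x r : A (x, r) -> u x = r by exact: (dominated_graph_fun hp hA).
have [A0 Al Ap] := hA.
have uP t x y : u (iota t *: x + y) = t * u x + u y by apply: uE; exact: Al.
have u0 : u 0 = 0 by exact: uE.
have uZ t x : u (iota t *: x) = t * u x by rewrite -[iota t *: x]addr0 uP u0 addr0.
have uD x y : u (x + y) = u x + u y.
  by have := uP 1 x y; rewrite rmorph1 scale1r mul1r.
pose g x := iota (u x) - iota (u (J *: x)) * J.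
have gD x y : g (x + y) = g x + g y.
  by rewrite /g scalerDr !uD !rmorphD /=; ring.
have gZ t x : g (iota t *: x) = iota t * g x.
  by rewrite /g scalerA [J * _]mulrC -scalerA !uZ !rmorphM /=; ring.
have gJ x : g (J *: x) = J * g x.
  rewrite /g scalerA /J; case: (im_unit_cases s) => [->|JJ].
    by rewrite mul0r !mulr0 scale0r u0 !rmorph0 mul0r subr0.
  have uN : u (- x) = - u x.
    by have := uZ (-1) x; rewrite rmorphN1 scaleN1r mulN1r.
  rewrite JJ scaleN1r uN rmorphN mulrBr [im_unit s * (_ * _)]mulrCA JJ; ring.
have gl a x y : g (a *: x + y) = a * g x + g y.
  rewrite gD (re_decomp s a) -/J; congr (_ + _).
  rewrite scalerBl -scalerA -scaleNr -rmorphN gD !gZ gJ rmorphN; ring.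
have reg x : re (g x) = u x.
  by rewrite /g reD re_iota -mulNr -rmorphN reM re_im_unit mulr0 addr0.
exists g; split => // [v|x].
- have uj w : u (j w) = re (h w) by apply: uE; apply: fA; exists w.
  rewrite /g -linearZ !uj [RHS](re_decomp s) -/J.
  have := hl J v 0; rewrite addr0 => ->.
  have := hl (-1) 0 0; rewrite scaleN1r oppr0 addr0 mulN1r addNr => ->.
  by rewrite addr0.
(* Rotate [x] so that [g x] becomes real and nonnegative. *)
- have [->|gx0] := eqVneq (g x) 0; first by rewrite rabs0 (seminorm_ge0 _ hp).
  pose th := `|g x| / g x.
  have th1 : rabs th = 1.
    apply: (@iota_inj _ _ s); rewrite -rabsE rmorph1 normrM normfV normr_id.
    by rewrite mulfV // normr_eq0.
  have gth : g (th *: x) = `|g x|.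
    have := gl th x 0; have := gZ 0 0; rewrite rmorph0 scale0r mul0r !addr0 => ->.
    by rewrite addr0 => ->; rewrite /th mulfVK.
  have -> : rabs (g x) = u (th *: x) by rewrite -reg gth.
  apply: (le_trans (Ap _ _ (uA _))).
  by have := hp.2 th x; rewrite th1 mul1r.
Qed.

End HahnBanach.

(** * Gauges and extension of operators of finite rank *)

Section Gauge.
Context {R : realType} {K : numFieldType} (sc : scalars R K) {X : lmodType K}.
Local Notation iota := (iota sc).
Local Notation rabs := (rabs sc).

(** [G x] stands for the costs of the ways to decompose [x]; the gauge is the least cost. The
    hypotheses say that decompositions can be added and scaled. *)
Lemma inf_seminorm (G : X -> set R) :
  (forall x, G x !=set0) -> (forall x r, G x r -> 0 <= r) ->
  (forall x y a b, G x a -> G y b -> G (x + y) (a + b)) ->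
  (forall k x r, G x r -> G (k *: x) (rabs k * r)) ->
  seminorm sc (fun x => inf (G x)) /\ forall x r, G x r -> inf (G x) <= r.
Proof.
move=> G0 Gge GD GZ.
have hG x : has_inf (G x) by split => //; exists 0 => r /Gge.
have lei x r : G x r -> inf (G x) <= r by move=> Gr; apply: ge_inf => //; apply: (hG x).2.
split=> //; split.
- move=> x y; apply/ler_addgt0Pr => e e0.
  have e20 : 0 < e / 2 by rewrite divr_gt0.
  have [a Ga a_lt] := inf_adherent e20 (hG x).
  have [b Gb b_lt] := inf_adherent e20 (hG y).
  by have := lei _ _ (GD _ _ _ _ Ga Gb); lra.
- move=> k x; have [k0|k0] := leP (rabs k) 0.
    have kE : rabs k = 0 by apply/eqP; rewrite eq_le k0 rabs_ge0.
    have [r Gr] := G0 x; have := lei _ _ (GZ k _ _ Gr).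
    by rewrite kE !mul0r.
  rewrite mulrC -ler_pdivrMr //; apply: lb_le_inf => // r Gr.
  by rewrite ler_pdivrMr // mulrC; apply: lei; exact: GZ.
Qed.

Definition abs_convex (C : set X) := C 0 /\
  forall a b x y, C x -> C y -> rabs a + rabs b <= 1 -> C (a *: x + b *: y).

Lemma abs_convex_scale C a x : abs_convex C -> C x -> rabs a <= 1 -> C (a *: x).
Proof.
move=> [C0 CP] Cx a1; have := CP a 0 x 0 Cx C0.
by rewrite scaler0 addr0 rabs0 addr0; apply.
Qed.

Definition abs_convex_hull (A : set X) : set X :=
  [set x | forall C, abs_convex C -> A `<=` C -> C x].

Lemma abs_convex_hullP A : abs_convex (abs_convex_hull A).
Proof.
split=> [C [] //|a b x y hx hy ab C CP AC].
by apply: CP.2 => //; [exact: hx|exact: hy].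
Qed.

Lemma sub_abs_convex_hull A : A `<=` abs_convex_hull A.
Proof. by move=> x Ax C _; exact. Qed.

End Gauge.

Section Extension.
Context {R : realType} {K : numFieldType} (sc : scalars R K).
Local Notation iota := (iota sc).
Local Notation rabs := (rabs sc).
Local Notation rnorm := (rnorm sc).

(** An isomorphism of l_infinity^n onto the range of [S] with distortion at most [r * t], expressed
    through coordinates since Hahn-Banach is applied to each of them. *)
Definition fd_iso (W : normedModType K) n (S : {linear 'rV[K]_n -> W}) (t r : R) :=
  [/\ 0 <= t, 0 <= r, forall (a : 'rV[K]_n) i, rabs (a 0 i) <= t * rnorm (S a) &
      forall (a : 'rV[K]_n) M, 0 <= M ->
        (forall i, rabs (a 0 i) <= M) -> rnorm (S a) <= r * M].

Lemma fd_iso_inj (W : normedModType K) n (S : {linear 'rV[K]_n -> W}) t r :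
  fd_iso S t r -> injective S.
Proof.
move=> [t0 r0 hS _] a b Sab; apply/rowP => i; apply/eqP; rewrite -subr_eq0.
apply/eqP/(@rabs_eq0 _ _ sc); have := hS (a - b) i.
by rewrite linearB Sab subrr rnorm0 mulr0 !mxE.
Qed.

(** This is the injectivity of l_infinity^n: each coordinate of the inverse of [S] composed with [v]
    is dominated by [t * p] and extends with the same bound. In the sup norm this costs nothing
    more, so only the distortion is lost. *)
Lemma extend_fd (W : normedModType K) n (S : {linear 'rV[K]_n -> W}) t r
    (X U : lmodType K) (j : {linear U -> X}) (v : {linear U -> W}) p :
  fd_iso S t r -> seminorm sc p -> (forall u, exists a, v u = S a) ->
  (forall u, rnorm (v u) <= p (j u)) ->
  exists V : {linear X -> W},
    [/\ forall u, V (j u) = v u, forall x, rnorm (V x) <= r * t * p x &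
        forall x, exists a, V x = S a].
Proof.
move=> hS hp /choice[a aE] vp; have [t0 r0 tS rS] := hS.
have al k u u' : a (k *: u + u') = k *: a u + a u'.
  by apply: (fd_iso_inj hS); rewrite -aE !linearP /= -!aE.
have hq : seminorm sc (fun x => t * p x).
  split=> [x y|k x]; first by rewrite -mulrDr ler_wpM2l // hp.1.
  by rewrite mulrCA ler_wpM2l // hp.2.
have /choice[g gP] i : exists g : X -> K,
    [/\ forall a x y, g (a *: x + y) = a * g x + g y,
        forall u, g (j u) = a u 0 i & forall x, rabs (g x) <= t * p x].
  apply: (hahn_banach (h := fun u => a u 0 i) hq) => [k u u'|u].
    by rewrite al !mxE.
  by rewrite (le_trans (tS _ _)) // ler_wpM2l // -aE.
have [|V VE] := @linear_pack K X W (fun x => S (\row_i g i x)).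
  move=> k x y; rewrite -linearP; congr (S _); apply/rowP => i; rewrite !mxE.
  by have [-> _ _] := gP i.
exists V; split=> [u|x|x]; rewrite VE.
- rewrite aE; congr (S _); apply/rowP => i; rewrite mxE.
  by have [_ -> _] := gP i.
- rewrite -mulrA; apply: rS; first by rewrite mulr_ge0 // (seminorm_ge0 _ hp).
  by move=> i; rewrite mxE; have [_ _] := gP i.
- by exists (\row_i g i x).
Qed.

Definition thickening (Y X : normedModType K) (j : Y -> X) (C : set X) (d : R) : set Y :=
  [set y | exists2 x, C x & rnorm (j y - x) <= d].

(** The bound on [C] involves neither [B] nor [d]: these affect only the norm of [V], of which
    nothing but finiteness is claimed. *)
Lemma extend_small (Y X W : normedModType K) n (S : {linear 'rV[K]_n -> W}) t r
    (j : {linear Y -> X}) (v : {linear Y -> W}) (C : set X) (c rho B d eta : R) :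
  fd_iso S t r -> 0 < c -> (forall y, c * rnorm y <= rnorm (j y)) ->
  abs_convex sc C -> (forall x, C x -> rnorm x <= rho) ->
  0 <= B -> (forall y, rnorm (v y) <= B * rnorm y) ->
  (forall y, exists a, v y = S a) ->
  0 < d -> 0 <= eta ->
  (forall y, thickening j C d y -> rnorm (v y) <= eta) ->
  exists V : {linear X -> W},
    [/\ forall y, V (j y) = v y, forall x, C x -> rnorm (V x) <= r * t * eta,
        exists M, forall x, rnorm (V x) <= M * rnorm x &
        forall x, exists a, V x = S a].
Proof.
move=> hS c0 jc hC Crho B0 vB vS d0 eta0 v_eta; have [C0 _] := hC.
have rho0 : 0 <= rho by rewrite (le_trans _ (Crho _ C0)) // rnorm0.
(* Chosen for points [y] whose remainder [e] after subtracting [tau z] exceeds [d * tau]: then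
   [tau <= e / d], so [c * rnorm y <= e + tau * rho <= (rho / d + 1) * e] and
   [B * rnorm y <= M * e]. *)
pose M := B / c * (rho / d + 1).
have M0 : 0 <= M by rewrite mulr_ge0 ?divr_ge0 ?addr_ge0 ?divr_ge0 // ltW.
pose G x := [set q | exists tau z,
  [/\ 0 <= tau, C z & eta * tau + M * rnorm (x - iota tau *: z) <= q]].
have [x|x q|x y a b|k x q|hp p_le] := @inf_seminorm _ _ sc X G.
- by exists (eta * 0 + M * rnorm (x - iota 0 *: 0)), 0, 0.
- move=> [tau [z [tau0 Cz]]]; apply: le_trans.
  by rewrite addr_ge0 // mulr_ge0 // rnorm_ge0.
- move=> [ta [z [ta0 Cz az]]] [tb [w [tb0 Cw bw]]].
  have [u Cu uE] : exists2 u, C u & iota (ta + tb) *: u = iota ta *: z + iota tb *: w.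
    have [tab|tab] := leP (ta + tb) 0.
      have [-> ->] : ta = 0 /\ tb = 0 by lra.
      by exists 0; rewrite // addr0 !rmorph0 !scale0r addr0.
    exists (iota (ta / (ta + tb)) *: z + iota (tb / (ta + tb)) *: w).
      apply: hC.2 => //; rewrite !rabs_iota !ger0_norm ?divr_ge0 ?addr_ge0 //.
      by rewrite -mulrDl mulfV ?gt_eqF.
    by rewrite scalerDr !scalerA -!rmorphM ![(_ + _) * (_ / _)]mulrC !divfK ?gt_eqF.
  exists (ta + tb), u; split=> //; first exact: addr_ge0.
  rewrite uE opprD addrACA.
  have := ler_wpM2l M0 (rnormD sc (x - iota ta *: z) (y - iota tb *: w)).
  by lra.
- move=> [tau [z [tau0 Cz zq]]].
  have [u Cu uE] : exists2 u, C u & iota (rabs k * tau) *: u = k *: (iota tau *: z).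
    have [->|k0] := eqVneq k 0.
      by exists 0; rewrite // rabs0 mul0r rmorph0 !scale0r.
    have nk0 : rabs k != 0.
      by apply: contra k0 => /eqP k0; rewrite (@rabs_eq0 _ _ sc k) ?k0.
    exists ((k / iota (rabs k)) *: z).
      apply: (abs_convex_scale hC) => //; rewrite rabsM -fmorphV rabs_iota.
      by rewrite ger0_norm ?invr_ge0 ?rabs_ge0 // mulfV.
    rewrite !scalerA rmorphM; congr (_ *: _).
    by field; rewrite fmorph_eq0.
  exists (rabs k * tau), u; split=> //; first by rewrite mulr_ge0 ?rabs_ge0.
  rewrite uE -scalerBr rnormZ; have := ler_wpM2l (rabs_ge0 sc k) zq; lra.
have vp y : rnorm (v y) <= inf (G (j y)).
  apply: lb_le_inf; first by exists (eta * 0 + M * rnorm (j y - iota 0 *: 0)), 0, 0.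
  move=> q [tau [z [tau0 Cz]]]; apply: le_trans.
  set e := rnorm (j y - _); have e0 : 0 <= e by exact: rnorm_ge0.
  have yn : c * rnorm y <= e + tau * rho.
    rewrite (le_trans (jc y)) // -[j y](subrK (iota tau *: z)).
    rewrite (le_trans (rnormD _ _ _)) //  lerD2l rnormZ rabs_iota ger0_norm //.
    by rewrite ler_wpM2l ?Crho.
  (* With a small remainder, [y] divided by [tau] lies in the thickening and the term [eta * tau]
     pays; otherwise the term [M * e] pays. *)
  have [ed|ed] := leP e (d * tau).
    have [tau_le|taup] := leP tau 0.
      have tauE : tau = 0 by lra.
      move: ed yn; rewrite tauE mulr0 mul0r addr0 => ed yn.
      have y0 : rnorm y <= 0 by rewrite -(pmulr_rle0 _ c0); lra.
      by rewrite (rnorm_eq0 y0) linear0 rnorm0 mulr0 add0r mulr_ge0.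
    suff : rnorm (v (iota tau^-1 *: y)) <= eta.
      rewrite linearZ rnormZ rabs_iota ger0_norm ?invr_ge0 //.
      by rewrite ler_pdivrMl // => h; nra.
    apply: v_eta; exists z => //.
    rewrite -[z](@scalerK _ _ (iota tau)) ?fmorph_eq0 ?gt_eqF // linearZ -fmorphV.
    rewrite -scalerBr rnormZ rabs_iota ger0_norm ?invr_ge0 //.
    by rewrite ler_pdivrMl // mulrC.
  have h1 : tau <= e / d by rewrite ler_pdivlMr // mulrC ltW.
  have h2 : rnorm y <= (e + tau * rho) / c by rewrite ler_pdivlMr // mulrC.
  have h3 : e + tau * rho <= (rho / d + 1) * e.
    have := ler_wpM2r rho0 h1; nra.
  have h4 : rnorm (v y) <= M * e.
    have -> : M * e = B * ((rho / d + 1) * e / c) by rewrite /M; ring.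
    rewrite (le_trans (vB y)) // ler_wpM2l // (le_trans h2) //.
    by rewrite ler_pM2r ?invr_gt0.
  by rewrite (le_trans h4) // lerDr mulr_ge0.
have [V [Vj Vp VS]] := extend_fd hS hp vS vp.
have [t0 r0 _ _] := hS.
have rt0 : 0 <= r * t by exact: mulr_ge0.
exists V; split=> // [x Cx|].
  apply: (le_trans (Vp x)); rewrite ler_wpM2l //; apply: p_le.
  by exists 1, x; rewrite rmorph1 scale1r subrr rnorm0 mulr0 addr0 mulr1.
exists (r * t * M) => x; apply: (le_trans (Vp x)).
rewrite -[leRHS]mulrA ler_wpM2l //; apply: p_le.
by exists 0, 0; rewrite mulr0 add0r scaler0 subr0.
Qed.

End Extension.

(** * Totally bounded sets *)

Lemma half_exp_small (R : realType) (M e : R) : 0 < e ->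
  exists n, M * 2^-1 ^+ n <= e.
Proof.
move=> e0; have h2 n : 0 < 2^-1 ^+ n :> R by rewrite exprn_gt0 // invr_gt0.
have [M0|M0] := leP M 0.
  by exists 0%N; rewrite expr0 mulr1 (le_trans M0) // ltW.
exists (Num.truncn (M / e)).+1; rewrite exprVn ler_pdivrMr ?exprn_gt0 //.
rewrite mulrC -ler_pdivrMr //.
have := truncnS_gt (M / e); set n := (Num.truncn _).+1 => /ltW h.
by rewrite (le_trans h) // -natrX ler_nat ltnW // ltn_expl.
Qed.

Lemma half_exp_le (R : realType) n m : (n <= m)%N -> 2^-1 ^+ m <= 2^-1 ^+ n :> R.
Proof. by move=> nm; apply: ler_wiXn2l => //; lra. Qed.

Section TotallyBounded.
Context {R : realType} {K : numFieldType} (sc : scalars R K).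
Local Notation iota := (iota sc).
Local Notation re := (re sc).
Local Notation rabs := (rabs sc).
Local Notation rnorm := (rnorm sc).
Implicit Types V W : normedModType K.

Definition totally_bounded V (A : set V) := forall e : R, 0 < e ->
  exists l : seq V, forall x, A x -> exists2 y, y \in l & rnorm (x - y) <= e.

Lemma tb_approx V (A : set V) :
  (forall e : R, 0 < e -> exists B : set V, totally_bounded B /\
     forall x, A x -> exists2 y, B y & rnorm (x - y) <= e) ->
  totally_bounded A.
Proof.
move=> h e e0; have e20 : 0 < e / 2 by rewrite divr_gt0.
have [B [/(_ _ e20)[l lP] AB]] := h _ e20; exists l => x /AB[y By xy].
have [z zl yz] := lP _ By; exists z => //.
by have := rnormD sc (x - y) (y - z); rewrite addrA subrK; lra.
Qed.

Lemma tb_sub V (A B : set V) : A `<=` B -> totally_bounded B -> totally_bounded A.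
Proof. by move=> AB hB e /hB[l lP]; exists l => x /AB; exact: lP. Qed.

Lemma tb_seq V (l : seq V) : totally_bounded [set x | x \in l].
Proof.
by move=> e e0; exists l => x xl; exists x; rewrite // subrr rnorm0 ltW.
Qed.

Lemma tb_setU V (A B : set V) :
  totally_bounded A -> totally_bounded B -> totally_bounded (A `|` B).
Proof.
move=> hA hB e e0; have [l lP] := hA _ e0; have [m mP] := hB _ e0.
exists (l ++ m) => x [/lP|/mP] [y yl xy]; exists y => //.
  by rewrite mem_cat yl.
by rewrite mem_cat yl orbT.
Qed.

Lemma tb_finite_union V (A : nat -> set V) n : (forall i, totally_bounded (A i)) ->
  totally_bounded [set x | exists2 i, (i <= n)%N & A i x].
Proof.
move=> hA; elim: n => [|n IH].
  by apply: tb_sub (hA 0%N) => x [k]; rewrite leqn0 => /eqP ->.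
apply: tb_sub (tb_setU IH (hA n.+1)) => x [k]; rewrite leq_eqVlt => /orP[/eqP ->|].
  by right.
by left; exists k.
Qed.

Lemma tb_add V (A B : set V) : totally_bounded A -> totally_bounded B ->
  totally_bounded [set z | exists x y, [/\ A x, B y & z = x + y]].
Proof.
move=> hA hB e e0; have e20 : 0 < e / 2 by rewrite divr_gt0.
have [l lP] := hA _ e20; have [m mP] := hB _ e20.
exists [seq x + y | x <- l, y <- m] => _ [x [y [/lP[x' x'l xx'] /mP[y' y'm yy'] ->]]].
exists (x' + y'); first exact: allpairs_f.
by rewrite opprD addrACA; have := rnormD sc (x - x') (y - y'); lra.
Qed.

Lemma tb_image V W (f : {linear V -> W}) M (A : set V) :
  (forall x, rnorm (f x) <= M * rnorm x) -> totally_bounded A ->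
  totally_bounded (f @` A).
Proof.
move=> fM hA e e0; have M1 : 0 < `|M| + 1 by rewrite ltr_wpDl.
have [l lP] := hA _ (divr_gt0 e0 M1); exists (map f l) => _ [x /lP[y yl xy] <-].
exists (f y); first exact: map_f.
rewrite -linearB (le_trans (fM _)) // (@le_trans _ _ ((`|M| + 1) * rnorm (x - y))) //.
  by rewrite ler_wpM2r ?rnorm_ge0 // (le_trans (ler_norm M)) // lerDl.
by rewrite mulrC -ler_pdivlMr.
Qed.

Lemma tb_real_disc V (v : V) :
  totally_bounded [set x | exists2 a : R, `|a| <= 1 & x = iota a *: v].
Proof.
move=> e e0; pose d := e / (rnorm v + 1).
have v1 : 0 < rnorm v + 1 by rewrite ltr_wpDl ?rnorm_ge0.
have d0 : 0 < d by exact: divr_gt0.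
exists [seq iota (i%:R * d - 1) *: v | i <- seq.iota 0 (Num.truncn (2 / d)).+1].
move=> _ [a a1 ->]; have /andP[a_ge a_le] : -1 <= a <= 1 by rewrite -ler_norml.
pose i := Num.truncn ((a + 1) / d).
have ad0 : 0 <= (a + 1) / d by rewrite divr_ge0 ?(ltW d0) //; lra.
exists (iota (i%:R * d - 1) *: v).
  apply: (map_f (fun i : nat => iota (i%:R * d - 1) *: v)).
  rewrite mem_iota add0n ltnS /=; apply: le_truncn.
  by rewrite ler_pM2r ?invr_gt0 //; lra.
have /andP[i_le i_gt] := truncn_itv ad0; rewrite -/i in i_le i_gt.
move: i_le i_gt; rewrite ler_pdivlMr // ltr_pdivrMr // -natr1 mulrDl mul1r => i_le i_gt.
rewrite -scalerBl -rmorphB rnormZ rabs_iota ger0_norm; last by lra.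
have h : a - (i%:R * d - 1) <= d by lra.
rewrite (le_trans (ler_wpM2r (rnorm_ge0 sc v) h)) // /d mulrAC.
by rewrite ler_pdivrMr // ler_pM2l // lerDl.
Qed.

(** By [re_decomp] a scalar of modulus at most 1 has two real components of modulus at most 1, so
    the disc lies in the sum of the real discs of [v] and [im_unit sc *: v]. *)
Lemma tb_disc V (v : V) :
  totally_bounded [set x | exists2 a, rabs a <= 1 & x = a *: v].
Proof.
have h := tb_add (tb_real_disc v) (tb_real_disc (im_unit sc *: v)).
have re_le (a : K) : `|re a| <= rabs a.
  rewrite ler_norml le_re_norm andbT -[re a]opprK lerN2 -mulN1r -(reM sc).
  rewrite rmorphN1 mulN1r (le_trans (le_re_norm _ _)) // normrN //.
apply: tb_sub h => _ [a a1 ->].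
exists (iota (re a) *: v), (iota (- re (im_unit sc * a)) *: (im_unit sc *: v)).
split.
- by exists (re a) => //; exact: le_trans (re_le _) a1.
- exists (- re (im_unit sc * a)) => //; rewrite normrN (le_trans (re_le _)) //.
  by rewrite rabsM mulr_ile1 ?rabs_ge0 ?rabs_im_unit.
- by rewrite {1}(re_decomp sc a) scalerBl -scalerA rmorphN scaleNr.
Qed.

(** The hull lies in any absolutely convex set containing [A]. Here this is the set of points within
    [e] of a combination, with weights of total modulus at most 1, of a finite net; such
    combinations lie in a finite sum of discs. *)
Lemma tb_abs_convex_hull V (A : set V) :
  totally_bounded A -> totally_bounded (abs_convex_hull sc A).
Proof.
move=> hA; apply: tb_approx => e e0; have [l lP] := hA _ e0.
pose P (a : nat -> K) : V := \sum_(i < size l) a i *: l`_i.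
exists [set x | exists2 a : nat -> K, (forall i, rabs (a i) <= 1) & x = P a]; split.
  rewrite /P; elim: {lP P} l => [|v l IH].
    by apply: tb_sub (tb_seq [:: 0]) => _ [a _ ->]; rewrite /= big_ord0 inE.
  apply: tb_sub (tb_add (tb_disc v) IH) => _ [a a1 ->].
  exists (a 0%N *: v), (\sum_(i < size l) a i.+1 *: l`_i); split.
  - by exists (a 0%N).
  - by exists (fun i => a i.+1).
  - by rewrite big_ord_recl.
pose C := [set x | exists a : nat -> K,
  \sum_(i < size l) rabs (a i) <= 1 /\ rnorm (x - P a) <= e].
move=> x /(_ C)[| |a [a1 xa]].
- split.
    exists (fun=> 0); split; first by rewrite big1 // => i _; rewrite rabs0.
    by rewrite /P big1 => [|i _]; rewrite ?scale0r // subrr rnorm0 ltW.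
  move=> a b x' y [u [u1 xu]] [w [w1 yw]] ab1.
  exists (fun i => a * u i + b * w i); split.
    rewrite (le_trans _ ab1) //.
    pose B := \sum_(i < size l) (rabs a * rabs (u i) + rabs b * rabs (w i)).
    rewrite (@le_trans _ _ B) // /B.
      by apply: ler_sum => i _; rewrite -!rabsM rabsD.
    rewrite big_split /= -!mulr_sumr.
    have := ler_wpM2l (rabs_ge0 sc a) u1; have := ler_wpM2l (rabs_ge0 sc b) w1; lra.
  have -> : a *: x' + b *: y - P (fun i => a * u i + b * w i) =
            a *: (x' - P u) + b *: (y - P w).
    rewrite !scalerBr addrACA -opprD; congr (_ - _).
    rewrite /P !scaler_sumr -big_split; apply: eq_bigr => i _.
    by rewrite scalerDl !scalerA.
  rewrite (le_trans (rnormD _ _ _)) // !rnormZ.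
  have := ler_wpM2l (rabs_ge0 sc a) xu; have := ler_wpM2l (rabs_ge0 sc b) yw; nra.
- move=> y /lP[z zl yz]; exists (fun i => if i == index z l then 1 else 0).
  have iz : (index z l < size l)%N by rewrite index_mem.
  split.
    rewrite (bigD1 (Ordinal iz)) //= eqxx rabs1 big1 ?addr0 // => i /eqP ni.
    by case: eqP => [ii|_]; [case: ni; apply: val_inj|rewrite rabs0].
  rewrite /P (bigD1 (Ordinal iz)) //= eqxx scale1r nth_index // big1 ?addr0 //.
  move=> i /eqP ni.
  by case: eqP => [ii|_]; [case: ni; apply: val_inj|rewrite scale0r].
(* The sum bounds only the coefficients with index below [size l]; the others are reset to 0. *)
- exists (P a) => //; exists (fun i => if (i < size l)%N then a i else 0).
    move=> i; case: ifP => il; last by rewrite rabs0.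
    rewrite (le_trans _ a1) // (bigD1 (Ordinal il)) //= lerDl.
    by rewrite sumr_ge0 // => k _; rewrite rabs_ge0.
  by apply: eq_bigr => i _; rewrite ltn_ord.
Qed.

Lemma tb_bounded V (A : set V) : totally_bounded A ->
  exists rho, forall x, A x -> rnorm x <= rho.
Proof.
move=> /(_ 1 ltr01)[l lP]; exists (\sum_(y <- l) rnorm y + 1) => x /lP[y yl xy].
have yle : rnorm y <= \sum_(y <- l) rnorm y.
  by rewrite (big_rem y) //= lerDl sumr_ge0 // => k _; rewrite rnorm_ge0.
by have := rnormD sc (x - y) y; rewrite subrK; lra.
Qed.

(** Each centre whose ball meets the image of [A] is replaced by such an image point, which doubles
    the radius. This yields nets made of points of a subspace out of centres in the whole space. *)
Lemma recenter_cover (T : choiceType) V (f : T -> V) (A : set T) (l : seq V) r :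
  (forall x, A x -> exists2 y, y \in l & rnorm (f x - y) <= r) ->
  exists m : seq T, (forall x, x \in m -> A x) /\
    forall x, A x -> exists2 y, y \in m & rnorm (f x - f y) <= 2 * r.
Proof.
elim: l A => [|y l IH] A lP.
  by exists [::]; split=> // x /lP[].
have [|m [mA mP]] := IH [set x | A x /\ r < rnorm (f x - y)].
  move=> x [/lP[z]]; rewrite inE => /orP[/eqP ->|zl xz _]; last by exists z.
  by move=> h1 h2; lra.
have [[x0 [Ax0 x0y]]|nx0] := pselect (exists x, A x /\ rnorm (f x - y) <= r).
  exists (x0 :: m); split=> [x|x Ax].
    by rewrite inE => /orP[/eqP ->//|/mA []].
  have [xy|xy] := leP (rnorm (f x - y)) r.
    exists x0; first by rewrite inE eqxx.
    have := rnormD sc (f x - y) (y - f x0); rewrite addrA subrK.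
    by rewrite (rnorm_sub _ y); lra.
  by have [z zm xz] := mP _ (conj Ax xy); exists z; rewrite // inE zm orbT.
exists m; split=> [x /mA[]//|x Ax]; apply: mP; split=> //.
by rewrite ltNge; apply/negP => h; apply: nx0; exists x.
Qed.

(** The range of a sequence tending to 0, without an enumeration: only finitely many points lie
    outside any given ball about 0. *)
Definition null_set V (N : set V) := forall e : R, 0 < e ->
  exists l : seq V, forall x, N x -> x \in l \/ rnorm x <= e.

Lemma null_set_tb V (N : set V) : null_set N -> totally_bounded N.
Proof.
move=> hN e e0; have [l lP] := hN _ e0; exists (0 :: l) => x /lP[xl|xe].
  by exists x; rewrite ?inE ?xl ?orbT // subrr rnorm0 ltW.
by exists 0; rewrite ?inE ?eqxx // subr0.
Qed.

(* Every point of [A] is a sum of terms [2^-k y_k] with [y_k] in [N]. *)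
Lemma tb_null_set V (A : set V) : totally_bounded A ->
  exists2 N : set V, null_set N &
    forall W (F : {linear V -> W}) M e, (forall x, rnorm (F x) <= M * rnorm x) ->
      (forall y, N y -> rnorm (F y) <= e) -> forall x, A x -> rnorm (F x) <= 2 * e.
Proof.
move=> hA; have h0 n : 0 < 2^-1 ^+ n :> R by rewrite exprn_gt0 // invr_gt0.
(* Accuracy [4^-n] makes consecutive approximations differ by at most [2 * 4^-n], so that after
   multiplication by [2^(n+1)] the differences, at most [4 * 2^-n], still tend to 0. *)
have /choice[l lP] n : exists l : seq V, forall x, A x ->
    exists2 y, y \in l & rnorm (x - y) <= 2^-1 ^+ n * 2^-1 ^+ n.
  by apply: hA; exact: mulr_gt0.
pose D n : seq V := [seq iota (2 ^+ n.+1) *: (b - a) | a <- l n, b <- l n.+1].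
pose N := [set y | y \in l 0%N \/ exists2 n, y \in D n & rnorm y <= 4 * 2^-1 ^+ n].
exists N.
  move=> e e0; have [n ne] := @half_exp_small R 4 e e0.
  exists (l 0%N ++ flatten [seq D i | i <- seq.iota 0 n]) => y [yl|[i yD yi]].
    by left; rewrite mem_cat yl.
  have [ni|ni] := leqP n i.
    by right; rewrite (le_trans yi) // (le_trans _ ne) // ler_wpM2l // half_exp_le.
  left; rewrite mem_cat; apply/orP; right; apply/flattenP; exists (D i) => //.
  by apply: map_f; rewrite mem_iota.
move=> W F M e FM Ne x Ax.
have /choice[y yP] n : exists y, y \in l n /\ rnorm (x - y) <= 2^-1 ^+ n * 2^-1 ^+ n.
  by have [y yl xy] := lP n x Ax; exists y.
have e0 : 0 <= e by apply: le_trans (rnorm_ge0 _ _) (Ne (y 0%N) _); left; case: (yP 0%N).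
have Fy n : rnorm (F (y n)) <= (2 - 2^-1 ^+ n) * e.
  elim: n => [|n IH].
    have -> : (2 - 2^-1 ^+ 0) * e = e by rewrite expr0; ring.
    by apply: Ne; left; case: (yP 0%N).
  pose d := iota (2 ^+ n.+1) *: (y n.+1 - y n).
  have yE : y n.+1 = y n + iota (2^-1 ^+ n.+1) *: d.
    rewrite /d scalerA -rmorphM -exprMn mulVf // expr1n rmorph1 scale1r.
    by rewrite addrC subrK.
  have Nd : N d.
    right; exists n; first by apply: allpairs_f; [case: (yP n)|case: (yP n.+1)].
    rewrite /d rnormZ rabs_iota ger0_norm ?exprn_ge0 //.
    have [_ y1] := yP n; have [_ y2] := yP n.+1.
    have y3 : rnorm (y n.+1 - y n) <= 2 * (2^-1 ^+ n * 2^-1 ^+ n).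
      have := rnormD sc (y n.+1 - x) (x - y n); rewrite addrA subrK.
      rewrite (rnorm_sub _ _ x) => h.
      have : 2^-1 ^+ n.+1 * 2^-1 ^+ n.+1 <= 2^-1 ^+ n * 2^-1 ^+ n :> R.
        by apply: ler_pM; rewrite ?(ltW (h0 _)) ?half_exp_le.
      by lra.
    rewrite (le_trans (ler_wpM2l _ y3)) ?exprn_ge0 //.
    have E : 2 ^+ n * 2^-1 ^+ n = 1 :> R by rewrite -exprMn mulfV // expr1n.
    move: E; rewrite exprS; set h := 2^-1 ^+ n; set g := 2 ^+ n => E.
    have -> : 2 * g * (2 * (h * h)) = 4 * (g * h) * h by ring.
    by rewrite E mulr1.
  rewrite yE linearD linearZ (le_trans (rnormD _ _ _)) // rnormZ rabs_iota.
  rewrite ger0_norm ?(ltW (h0 _)) // exprS.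
  by have := ler_wpM2l (ltW (h0 n)) (Ne _ Nd); lra.
(* [M] serves only to pass to the limit in [n], which is why it does not enter the bound [2 * e]. *)
apply/ler_addgt0Pr => q q0; have [n nq] := @half_exp_small R `|M| q q0.
have [_ xy] := yP n; have := rnormD sc (F (x - y n)) (F (y n)).
rewrite -linearD subrK => h; have h1 := FM (x - y n); have h2 := Fy n.
have h3 : M * rnorm (x - y n) <= `|M| * 2^-1 ^+ n.
  rewrite (le_trans (ler_wpM2r (rnorm_ge0 _ _) (ler_norm M))) // ler_wpM2l //.
  rewrite (le_trans xy) // ler_piMr ?(ltW (h0 _)) //.
  by rewrite exprn_ile1 ?invr_ge0 // invf_le1 ?ler1n.
by have := mulr_ge0 (ltW (h0 n)) e0; lra.
Qed.

End TotallyBounded.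

(** * Finite dimension *)

Section LinearAlgebra.
Context {K : numFieldType} {V : normedModType K}.

Lemma lin_indep_span_le m n (w : 'I_m -> V) (v : 'I_n -> V) :
  lin_indep w -> (forall i, lin_span v (w i)) -> (m <= n)%N.
Proof.
move=> hw /choice[A AE]; rewrite leqNgt; apply/negP => nm.
pose M : 'M[K]_(m, n) := \matrix_(i, k) A i k.
have : kermx M != 0.
  rewrite kermx_eq0 /row_free; apply: contraTneq nm => <-.
  by rewrite -leqNgt rank_leq_col.
move=> /rowV0Pn[u /sub_kermxP uM /eqP]; apply; apply/rowP => i; rewrite mxE.
apply: (hw (fun i => u 0 i)).
rewrite (eq_bigr (fun i => \sum_k (u 0 i * A i k) *: v k)); last first.
  by move=> k _; rewrite AE scaler_sumr; apply: eq_bigr => l _; rewrite scalerA.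
rewrite exchange_big big1 // => k _; rewrite -scaler_suml.
have /rowP/(_ k) := uM; rewrite !mxE => uk.
rewrite (eq_bigr (fun i => u 0 i * M i k)) ?uk ?scale0r // => l _.
by rewrite mxE.
Qed.

Lemma lin_indep_cons n (w : 'I_n -> V) x : lin_indep w -> ~ lin_span w x ->
  lin_indep (fun i => if unlift ord0 i is Some k then w k else x).
Proof.
move=> hw nx a; rewrite big_ord_recl unlift_none.
rewrite (eq_bigr (fun i => a (lift ord0 i) *: w i)); last first.
  by move=> i _; rewrite liftK.
move=> aE; have a0 : a ord0 = 0.
  apply/eqP; apply: contrapT => /negP a0; apply: nx.
  exists (fun i => - (a ord0)^-1 * a (lift ord0 i)).
  under eq_bigr do rewrite -scalerA; rewrite -scaler_sumr.
  have /eqP := aE; rewrite addrC addr_eq0 => /eqP ->.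
  by rewrite scaleNr scalerN opprK scalerA mulVf // scale1r.
move: aE; rewrite a0 scale0r add0r => /hw aE i.
by case: (unliftP ord0 i) => [k ->|->].
Qed.

(** Independent families in [E] have length at most [n]; one of maximal length spans [E], since
    otherwise [lin_indep_cons] would lengthen it. *)
Lemma finite_dim_subspace_sub n (v : 'I_n -> V) (E : set V) :
  E 0 -> (forall a x y, E x -> E y -> E (a *: x + y)) -> E `<=` lin_span v ->
  finite_dim_subspace E.
Proof.
move=> E0 El Ev.
pose P m := `[< exists w : 'I_m -> V, lin_indep w /\ forall i, E (w i) >].
have exP : exists m, P m.
  exists 0%N; apply/asboolP; exists (fun=> 0); split=> [a _|]; by case.
have Pn m : P m -> (m <= n)%N.
  by move=> /asboolP[w [hw Ew]]; apply: (lin_indep_span_le (v := v) hw) => i; exact/Ev.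
have [m /asboolP[w [hw Ew]] maxm] := ex_maxnP exP Pn.
have spanE a : E (\sum_i a i *: w i).
  apply: big_ind => // [x y Ex Ey|i _]; first by rewrite -[x]scale1r; exact: El.
  by rewrite -[_ *: _]addr0; exact: El.
exists m, w; split=> //; apply/seteqP; split=> [x Ex|_ [a ->]//].
apply: contrapT => nx; have := maxm m.+1; rewrite ltnn.
suff -> : P m.+1 by move=> /(_ isT).
apply/asboolP; eexists; split; first exact: lin_indep_cons nx.
by move=> i /=; case: (unlift ord0 i) => [k|]; [exact: Ew|].
Qed.

Lemma lin_span0 n (v : 'I_n -> V) : lin_span v 0.
Proof. by exists (fun=> 0); rewrite big1 // => i _; rewrite scale0r. Qed.

Lemma lin_spanP n (v : 'I_n -> V) a x y :
  lin_span v x -> lin_span v y -> lin_span v (a *: x + y).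
Proof.
move=> [b ->] [c ->]; exists (fun i => a * b i + c i).
rewrite scaler_sumr -big_split; apply: eq_bigr => i _.
by rewrite scalerDl scalerA.
Qed.

Lemma lin_span_seq (l : seq V) : exists n (v : 'I_n -> V),
  forall x, x \in l -> lin_span v x.
Proof.
exists (size l), (fun i => l`_i) => x xl.
have ix : (index x l < size l)%N by rewrite index_mem.
exists (fun i => (i == Ordinal ix)%:R); rewrite (bigD1 (Ordinal ix)) //= eqxx.
rewrite scale1r nth_index // big1 ?addr0 // => i /negPf ->.
by rewrite scale0r.
Qed.

Lemma lin_span_finite_dim n (v : 'I_n -> V) : finite_dim_subspace (lin_span v).
Proof.
apply: (@finite_dim_subspace_sub n v) => //; first exact: lin_span0.
by move=> a x y; exact: lin_spanP.
Qed.

End LinearAlgebra.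

Section FiniteRank.
Context {K : numFieldType}.
Implicit Types V W : normedModType K.

(** Finite rank without a basis of the exact range: this form passes to sums and compositions at
    once, and [spanned_range_finite_rank] converts it back. *)
Definition spanned_range (T : Type) W (f : T -> W) :=
  exists n (v : 'I_n -> W), forall x, lin_span v (f x).

Lemma spanned_rangeD T W (f g : T -> W) :
  spanned_range f -> spanned_range g -> spanned_range (fun x => f x + g x).
Proof.
move=> [n [v fv]] [m [w gw]].
exists (n + m)%N, (fun i : 'I_(n + m) =>
  match fintype.split i with inl k => v k | inr k => w k end).
move=> x; have [a ->] := fv x; have [b ->] := gw x.
exists (fun i : 'I_(n + m) => match fintype.split i with inl k => a k | inr k => b k end).
by rewrite big_split_ord /=; congr (_ + _); apply: eq_bigr => i _;
  [rewrite (unsplitK (inl i))|rewrite (unsplitK (inr i))].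
Qed.

Lemma spanned_range_linear T V W (f : T -> V) (g : {linear V -> W}) :
  spanned_range f -> spanned_range (fun x => g (f x)).
Proof.
move=> [n [v fv]]; exists n, (fun i => g (v i)) => x; have [a ->] := fv x.
by exists a; rewrite linear_sum; apply: eq_bigr => i _; rewrite linearZ.
Qed.

Lemma spanned_range_comp T U W (f : U -> W) (g : T -> U) :
  spanned_range f -> spanned_range (fun x => f (g x)).
Proof. by move=> [n [v fv]]; exists n, v => x. Qed.

Lemma spanned_range_row T W n (S : {linear 'rV[K]_n -> W}) (f : T -> W) :
  (forall x, exists a, f x = S a) -> spanned_range f.
Proof.
move=> fS; exists n, (fun i => S (delta_mx 0 i)) => x; have [a ->] := fS x.
exists (fun i => a 0 i); rewrite {1}[a]row_sum_delta linear_sum.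
by apply: eq_bigr => i _; rewrite linearZ.
Qed.

Lemma spanned_range_finite_rank V W (f : {linear V -> W}) :
  spanned_range f -> finite_rank f.
Proof.
move=> [n [v fv]]; apply: (finite_dim_subspace_sub (v := v)).
- by exists 0; rewrite ?linear0.
- by move=> a _ _ [x _ <-] [y _ <-]; exists (a *: x + y); rewrite ?linearP.
- by move=> _ [x _ <-].
Qed.

End FiniteRank.

(** * Sup norms of row vectors and equivalence of norms *)

Lemma le_mx_norm (K : numFieldType) m n (a : 'M[K]_(m, n)) i k : `|a i k| <= `|a|.
Proof.
have h : (`|a i k|%:nng <= \big[Order.max/0%:nng]_i `|a i.1 i.2|%:nng)%O.
  exact: (le_bigmax 0%:nng (fun i : 'I_m * 'I_n => `|a i.1 i.2|%:nng) (i, k)).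
by move: h; rewrite -num_le.
Qed.

Lemma mx_norm_le (K : numFieldType) m n (a : 'M[K]_(m, n)) (M : K) : 0 <= M ->
  (forall i k, `|a i k| <= M) -> `|a| <= M.
Proof.
move=> M0 aM; have [a0|/mx_norm_neq0[[i k] E]] := eqVneq (mx_norm a) 0.
  by rewrite (_ : `|a| = mx_norm a) // a0.
by rewrite (_ : `|a| = mx_norm a) // E.
Qed.

Section EquivalentNorms.
Context {R : realType}.

(** [N] is continuous and the sup norm sphere compact, so the image of the sphere is closed and
    misses a ball about 0, whose radius is [c]. Arguing with a closed image instead of an attained
    minimum includes the empty sphere of [m = 0]. *)
Lemma norm_ge_sup_norm m (N : 'rV[R]_m -> R) :
  (forall x y, N (x + y) <= N x + N y) -> (forall a x, N (a *: x) = `|a| * N x) ->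
  (forall x, N x <= 0 -> x = 0) -> exists2 c, 0 < c & forall x, c * `|x| <= N x.
Proof.
move=> ND NZ N0.
have N00 : N 0 = 0 by have := NZ 0 0; rewrite scale0r normr0 mul0r.
have NN x : N (- x) = N x by rewrite -scaleN1r NZ normrN1 mul1r.
have N_ge0 x : 0 <= N x by have := ND x (- x); rewrite subrr N00 NN; lra.
pose L := \sum_i N (delta_mx 0 i).
have NL x : N x <= L * `|x|.
  rewrite {1}[x]row_sum_delta /L mulr_suml.
  apply: (big_ind2 (fun u v => N u <= v)); first by rewrite N00.
    by move=> u a v b ua vb; rewrite (le_trans (ND _ _)) // lerD.
  by move=> i _; rewrite NZ mulrC ler_wpM2l // le_mx_norm.
have L0 : 0 <= L by apply: sumr_ge0.
have Ncont : continuous N.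
  move=> x; apply/(@cvgrPdist_le _ _ _ _ (nbhs_filter x)) => e e0.
  have L1 : 0 < L + 1 by rewrite ltr_wpDl.
  suff : \forall y \near x, `|N x - N y| <= e by [].
  apply/nbhs_normP; exists (e / (L + 1)); first exact: divr_gt0.
  move=> y /= /ltW; rewrite ler_pdivlMr // mulrC => xy.
  apply: le_trans xy; rewrite (@le_trans _ _ (L * `|x - y|)) //.
    rewrite ler_norml; have := ND (x - y) y; have := ND (y - x) x.
    rewrite !subrK; have := NL (x - y); have := NL (y - x).
    by rewrite (distrC x y); lra.
  by rewrite ler_wpM2r ?lerDl.
pose Sph := [set x : 'rV[R]_m | `|x| = 1].
have cSph : compact Sph.
  apply: bounded_closed_compact.
    exists 1; split=> // M M1 x /= ->; exact: ltW.
  apply: (@preimage_closed _ _ (fun x : 'rV[R]_m => `|x|) [set 1]).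
    by move=> x _; exact: norm_continuous.
  exact: closed_eq.
have cN : closed (N @` Sph).
  apply: compact_closed => //; apply: continuous_compact => //.
  exact: continuous_subspaceT.
have : nbhs (0 : R) (~` (N @` Sph)).
  apply: open_nbhs_nbhs; split; first exact: closed_openC.
  move=> [x x1 Nx]; have x0 : x = 0 by apply: N0; rewrite Nx.
  by move: x1; rewrite /Sph /= x0 normr0 => /esym/eqP; rewrite oner_eq0.
move=> /nbhs_ballP[e /= e0 eN]; exists e => // x.
have [->|x0] := eqVneq x 0; first by rewrite normr0 mulr0.
have nx0 : 0 < `|x| by rewrite normr_gt0.
rewrite leNgt; apply/negP => h.
apply: (eN (N (`|x|^-1 *: x))).
  rewrite /ball /= sub0r normrN ger0_norm // NZ ger0_norm ?invr_ge0 //.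
  by rewrite mulrC ltr_pdivrMr.
exists (`|x|^-1 *: x) => //=.
by rewrite /Sph /= normrZ ger0_norm ?invr_ge0 // mulVf ?gt_eqF.
Qed.

Context {K : numFieldType} (sc : scalars R K).
Local Notation iota := (iota sc).
Local Notation re := (re sc).
Local Notation rabs := (rabs sc).
Local Notation rnorm := (rnorm sc).

Lemma re_add_le (a : K) : rabs a <= `|re a| + `|re (im_unit sc * a)|.
Proof.
rewrite {1}(re_decomp sc a) (le_trans (rabsD _ _ _)) // lerD //.
  by rewrite rabs_iota.
rewrite -mulNr -rmorphN rabsM rabs_iota normrN.
by rewrite ler_piMr // rabs_im_unit.
Qed.

(** The compactness argument is carried out over [R], so a vector of scalars is encoded by [n + n]
    real coordinates, which [k] decodes. *)
Lemma lin_indep_fd_iso (V : normedModType K) n (v : 'I_n -> V) : lin_indep v ->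
  exists (S : {linear 'rV[K]_n -> V}) t r,
    fd_iso sc S t r /\ forall a, S a = \sum_i a 0 i *: v i.
Proof.
move=> hv.
have [|S SE] := @linear_pack K 'rV[K]_n V (fun a => \sum_i a 0 i *: v i).
  move=> k a b; rewrite scaler_sumr -big_split; apply: eq_bigr => i _.
  by rewrite !mxE scalerDl scalerA.
pose J := im_unit sc.
pose k (c : 'rV[R]_(n + n)) i : K :=
  iota (c 0 (lshift n i)) - iota (c 0 (rshift n i)) * J.
(* The second summand vanishes over [R[i]]; over [R], where [J = 0], it controls the half
   of the coordinates that [k] ignores. *)
pose N c := rnorm (\sum_i k c i *: v i) +
  \sum_i `|c 0 (rshift n i) - re (J * k c i)|.
have kD c d i : k (c + d) i = k c i + k d i.
  by rewrite /k !mxE !rmorphD /=; ring.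
have kZ a c i : k (a *: c) i = iota a * k c i.
  by rewrite /k !mxE !rmorphM /=; ring.
have [|||m m0 mN] := @norm_ge_sup_norm _ N.
- move=> c d; rewrite /N addrACA lerD //.
    rewrite (eq_bigr (fun i => k c i *: v i + k d i *: v i)); last first.
      by move=> i _; rewrite kD scalerDl.
    by rewrite big_split /= rnormD.
  rewrite -big_split ler_sum // => i _; rewrite kD !mxE mulrDr reD opprD addrACA.
  exact: ler_normD.
- move=> a c; rewrite /N mulrDr; congr (_ + _).
    rewrite -(rabs_iota sc) -rnormZ scaler_sumr; congr (rnorm _).
    by apply: eq_bigr => i _; rewrite kZ scalerA.
  rewrite mulr_sumr; apply: eq_bigr => i _.
  by rewrite kZ mulrCA reM mxE -mulrBr normrM.
- move=> c; rewrite /N => Nc.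
  have s0 : 0 <= \sum_i `|c 0 (rshift n i) - re (J * k c i)| by apply: sumr_ge0.
  have r0 := rnorm_ge0 sc (\sum_i k c i *: v i).
  have k0 : forall i, k c i = 0 by apply: hv; apply: (@rnorm_eq0 _ _ sc); lra.
  have /eqP : \sum_i `|c 0 (rshift n i) - re (J * k c i)| = 0 by lra.
  rewrite psumr_eq0 // => /allP h.
  have cr i : c 0 (rshift n i) = 0.
    have := h i (mem_index_enum _); rewrite k0 mulr0 re0 subr0 normr_eq0 => /eqP //.
  have cl i : c 0 (lshift n i) = 0.
    have := k0 i; rewrite /k cr rmorph0 mul0r subr0 => /(congr1 re).
    by rewrite re_iota re0.
  apply/rowP => i; rewrite mxE; case: (split_ordP i) => l ->; [exact: cl|exact: cr].
have r_ge0 : 0 <= \sum_i rnorm (v i) by apply: sumr_ge0 => i _; exact: rnorm_ge0.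
(* The 2 counts the two real coordinates bounding one scalar in [re_add_le]. *)
exists S, (2 / m), (\sum_i rnorm (v i)); split=> //; split=> //.
- by rewrite divr_ge0 // ltW.
- move=> a i.
  pose c : 'rV[R]_(n + n) := row_mx (\row_i re (a 0 i)) (\row_i re (J * a 0 i)).
  have kc l : k c l = a 0 l.
    by rewrite /k row_mxEl row_mxEr !mxE -(re_decomp sc).
  have Nc : N c = rnorm (S a).
    rewrite /N SE [X in _ + X]big1 ?addr0; last first.
      by move=> l _; rewrite kc row_mxEr mxE subrr normr0.
    by congr (rnorm _); apply: eq_bigr => l _; rewrite kc.
  rewrite (le_trans (re_add_le _)) // mulrAC ler_pdivlMr // -Nc.
  have c1 := le_mx_norm c 0 (lshift n i); have c2 := le_mx_norm c 0 (rshift n i).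
  rewrite row_mxEl mxE in c1; rewrite row_mxEr mxE in c2.
  by have := mN c; rewrite -/J; nra.
- move=> a M M0 aM; rewrite SE mulr_suml.
  apply: (big_ind2 (fun u w => rnorm u <= w)); first by rewrite rnorm0.
    by move=> u p w q up wq; rewrite (le_trans (rnormD _ _ _)) // lerD.
  by move=> i _; rewrite rnormZ mulrC ler_wpM2l // rnorm_ge0.
Qed.

End EquivalentNorms.

(** * Convergence on compact sets *)

Section Boundary.
Context {R : realType} {K : numFieldType} (sc : scalars R K).
Local Notation iota := (iota sc).
Local Notation re := (re sc).
Local Notation rabs := (rabs sc).
Local Notation rnorm := (rnorm sc).
Implicit Types V W : normedModType K.

Lemma bounded_onP V W (E : set V) (f : V -> W) :
  bounded_on E f <->
  exists2 M, 0 <= M & forall x, E x -> rnorm (f x) <= M * rnorm x.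
Proof.
split=> [[M fM]|[M M0 fM]].
  (* [M] is a mere element of [K]: it need not be real if [E] has no nonzero point. *)
  exists (rabs M) => [|x Ex]; first exact: rabs_ge0.
  rewrite -(iota_le sc) rmorphM /= -rabsE -!rnormE (le_trans (fM _ Ex)) //.
  have [->|x0] := eqVneq x 0; first by rewrite normr0 !mulr0.
  rewrite ler_pM2r ?normr_gt0 // real_ler_norm //.
  have : 0 <= M * `|x| by apply: le_trans (fM _ Ex).
  by rewrite pmulr_lge0 ?normr_gt0 //; exact: ger0_real.
exists (iota M) => x /fM; rewrite -(iota_le sc) rmorphM /=.
by rewrite -!rnormE.
Qed.

Lemma bounded_opP V W (f : V -> W) :
  bounded_op f <-> exists2 M, 0 <= M & forall x, rnorm (f x) <= M * rnorm x.
Proof.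
split=> [/bounded_onP[M M0 fM]|[M M0 fM]]; first by exists M => // x; exact: fM.
by apply/bounded_onP; exists M.
Qed.

Lemma compact_tb V (A : set V) : compact A -> totally_bounded sc A.
Proof.
rewrite compact_cover => cA e e0.
have ie0 : 0 < iota e by rewrite iota_gt0.
have [||D DA AD] := cA V A (fun x => (ball x (iota e))°).
- by move=> x _; exact: open_interior.
- by move=> x Ax; exists x => //; apply: nbhsx_ballx.
exists (finmap.enum_fset D) => x /AD[y /= yD /interior_subset].
rewrite -ball_normE /ball_ /= => xy; exists y => //.
by rewrite rnorm_le distrC ltW.
Qed.

(** A filter that does not cluster at 0 contains a set missing some ball about 0, hence lives on
    finitely many points. *)
Lemma null_set_compact V (N : set V) : null_set sc N -> compact (0 |` N).
Proof.
move=> hN F PF FN; apply: contrapT => ncl.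
have nc0 : ~ cluster F 0 by move=> c0; apply: ncl; exists 0; split=> //; left.
have [A [B [FA B0 AB]]] : exists A B, [/\ F A, nbhs (0 : V) B & ~ (A `&` B !=set0)].
  apply: contrapT => h; apply: nc0 => A B FA B0; apply: contrapT => nAB.
  by apply: h; exists A, B.
move: B0 => /nbhs_normP[e /= e0 eB].
have e20 : 0 < re e / 2 by rewrite divr_gt0 // re_gt0.
have [l lP] := hN _ e20.
have Fl : F ((0 |` N) `&` [set x | x \in 0 :: l]).
  apply: filterS (filterI FA FN) => x [Ax Nx]; split=> //.
  case: Nx => [->|/lP[xl|xe]].
  - by rewrite /= inE eqxx.
  - by rewrite /= inE xl orbT.
  exfalso; apply: AB; exists x; split=> //; apply: eB.
  rewrite /ball_ /= sub0r normrN -(reE sc (ltW e0)) (rnormE sc) iota_lt.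
  by have := re_gt0 sc e0; lra.
have cl : compact ((0 |` N) `&` [set x | x \in 0 :: l]).
  by apply: finite_compact; apply: finite_setIr; exact: finite_seq.
have [x [[Nx _] clx]] := cl F PF Fl.
by apply: ncl; exists x.
Qed.

Lemma id_tau_limit_approx V (P : set {linear V -> V}) (A : set V) e :
  id_tau_limit P -> compact A -> 0 < e ->
  exists2 T, P T & forall x, A x -> rnorm (T x - x) <= e.
Proof.
move=> [I [le [T [dirle PT cvT]]]] cA e0.
have ie0 : 0 < iota e by rewrite iota_gt0.
have entE : entourage [set xy : V * V | ball xy.1 (iota e) xy.2].
  by rewrite -entourage_ballE; exists (iota e).
have [i0 /(_ i0)] := cvT _ (@fam_nbhs _ _ compact A _ id entE cA).
have [_ le_refl _ _] := dirle.
move=> /(_ (le_refl _)) h; exists (T i0) => // x /h.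
by rewrite /= -ball_normE /ball_ /= => xT; rewrite rnorm_le distrC ltW.
Qed.

(** The net is indexed by pairs of a totally bounded set and a tolerance, directed by enlarging the
    one and shrinking the other. *)
Lemma approx_id_tau_limit V (P : set {linear V -> V}) :
  (forall A e, totally_bounded sc A -> 0 < e ->
    exists2 T, P T & forall x, A x -> rnorm (T x - x) <= e) ->
  id_tau_limit P.
Proof.
move=> h.
pose ok (p : set V * R) := totally_bounded sc p.1 /\ 0 < p.2.
pose I := {p | ok p}.
pose le (p q : I) := (sval p).1 `<=` (sval q).1 /\ (sval q).2 <= (sval p).2.
have /choice[T TP] (p : I) : exists T, P T /\
    forall x, (sval p).1 x -> rnorm (T x - x) <= (sval p).2.
  by have [hA e0] := svalP p; have [T PT Te] := h _ _ hA e0; exists T.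
have ledir : directed le.
  split.
  - apply: inhabits; exists (set0, 1); split=> //= e e0.
    by exists [::].
  - by move=> p; split.
  - by move=> p q r [pq qp] [qr rq]; split; [exact: subset_trans qr|exact: le_trans qp].
  - move=> p q; have [pA p0] := svalP p; have [qA q0] := svalP q.
    have hr : ok ((sval p).1 `|` (sval q).1, Num.min (sval p).2 (sval q).2).
      by split; [exact: tb_setU|rewrite lt_min p0 q0].
    exists (exist ok _ hr); split; split=> /=.
    + exact: subsetUl.
    + by rewrite ge_min lexx.
    + exact: subsetUr.
    + by rewrite ge_min lexx orbT.
have Ft : Filter (tails le).
  have [[i0] lerefl letr ledr] := ledir.
  split.
  - by exists i0.
  - move=> A B [i Ai] [k Bk]; have [l [il kl]] := ledr i k.
    by exists l => m lm; split; [apply/Ai/(letr _ l)|apply/Bk/(letr _ l)].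
  - by move=> A B AB [i Ai]; exists i => k /Ai; exact: AB.
exists I, le, T; split=> // [p|]; first by case: (TP p).
apply/fam_cvgP => A cA.
move=> Q /uniform_nbhs[E [entE EQ]].
move: entE; rewrite -entourage_ballE => -[e /= e0 eE].
have re0' : 0 < re e / 2 by rewrite divr_gt0 // re_gt0.
have iP : ok (A, re e / 2).
  by split=> //; exact: compact_tb.
exists (exist ok _ iP) => p [/= Ap pe]; apply: EQ => x Ax; apply: eE => /=.
have [_ /(_ x (Ap x Ax)) Tx] := TP p.
rewrite -ball_normE /ball_ /= distrC -(reE sc (ltW e0)) (rnormE sc) iota_lt.
by rewrite (le_lt_trans Tx) // (le_lt_trans pe) //; have := re_gt0 sc e0; lra.
Qed.

End Boundary.

(** * Lifting through a quotient map *)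

Section OpenMapping.
Context {R : realType} {K : numFieldType} (sc : scalars R K).
Local Notation iota := (iota sc).
Local Notation re := (re sc).
Local Notation rabs := (rabs sc).
Local Notation rnorm := (rnorm sc).

(** As [r] at least halves at each step, the increments from index [n] on add up to at most
    [2 * r n]. *)
Lemma geometric_limit (V : completeNormedModType K) (u : nat -> V) (r : nat -> R) :
  (forall n, rnorm (u n.+1 - u n) <= r n) -> (forall n, r n.+1 <= r n / 2) ->
  exists l, forall n, rnorm (l - u n) <= 2 * r n.
Proof.
move=> ur r2.
have r0 n : 0 <= r n by apply: le_trans (rnorm_ge0 _ _) (ur n).
have udist n k : rnorm (u (n + k)%N - u n) <= 2 * r n.
  suff : rnorm (u (n + k)%N - u n) <= 2 * r n - 2 * r (n + k)%N.
    by have := r0 (n + k)%N; lra.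
  elim: k => [|k IH]; first by rewrite addn0 !subrr rnorm0.
  rewrite addnS; have := rnormD sc (u (n + k).+1 - u (n + k)%N) (u (n + k)%N - u n).
  by rewrite addrA subrK; have := ur (n + k)%N; have := r2 (n + k)%N; lra.
have rn n : r n <= r 0%N * 2^-1 ^+ n.
  elim: n => [|n IH]; first by rewrite expr0 mulr1.
  by rewrite exprS; have := r2 n; lra.
have : cvg (u @ \oo).
  apply: cauchy_cvg; apply: cauchy_exP => e e0.
  have re0' : 0 < re e / 2 by rewrite divr_gt0 // re_gt0.
  have [n nP] := half_exp_small (2 * r 0%N) re0'.
  exists (u n); exists n => // m /= nm.
  rewrite -ball_normE /ball_ /= -(reE sc (ltW e0)) (rnormE sc) iota_lt.
  rewrite rnorm_sub -(subnKC nm) (le_lt_trans (udist _ _)) //.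
  by have := rn n; have := re_gt0 sc e0; lra.
move=> /cvg_ex[l ul]; exists l => n.
apply/ler_addgt0Pr => e e0.
have ie0 : 0 < iota e by rewrite iota_gt0.
have [N _ NP] := cvgr_dist_le _ _ ul _ ie0.
have := NP (maxn N n) (leq_maxl N n); rewrite /= -rnorm_le => h.
have := udist n (maxn N n - n)%N; rewrite subnKC ?leq_maxr // => h2.
by have := rnormD sc (l - u (maxn N n)) (u (maxn N n) - u n); rewrite addrA subrK; lra.
Qed.

Lemma surjective_almost_open (V W : completeNormedModType K) (q : {linear V -> W}) :
  range q = setT ->
  exists z0 r (n : nat), 0 < r /\ forall z, rnorm (z - z0) <= r ->
    forall d, 0 < d -> exists2 x, rnorm x <= n%:R & rnorm (z - q x) <= d.
Proof.
move=> qsurj; apply: contrapT => nex.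
(* Otherwise there are nested balls, the [n]-th one avoiding the image of the ball of
   radius [n]; their common point is not in the range of [q]. *)
have step (s : W * R * nat) : exists z : W * R, 0 < s.1.2 ->
    [/\ rnorm (z.1 - s.1.1) <= s.1.2, 0 < z.2, z.2 <= s.1.2 / 2 &
        forall x, rnorm x <= s.2%:R -> 2 * z.2 < rnorm (z.1 - q x)].
  case: s => [[z0 r] n] /=; have [r0|r0] := leP r 0.
    by exists (z0, r).
  apply: contrapT => h; apply: nex; exists z0, r, n; split=> // z zr d d0.
  apply: contrapT => nx; apply: h; exists (z, Num.min (d / 2) (r / 2)) => _ /=.
  split=> //; first by rewrite lt_min !divr_gt0.
    by rewrite ge_min lexx orbT.
  move=> x xn; rewrite ltNge; apply/negP => zq; apply: nx; exists x => //.
  rewrite (le_trans zq) // mulrC -ler_pdivlMr //.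
  by rewrite ge_min lexx.
have [f fP] := choice step.
pose s := fix s n := if n is m.+1 then f (s m, m) else (0 : W, 1 : R).
have s0 n : 0 < (s n).2 by elim: n => [|n IH] //=; have [] := fP (s n, n) IH.
have [l lP] : exists l, forall n, rnorm (l - (s n).1) <= 2 * (s n).2.
  apply: geometric_limit => n /=; by have [] := fP (s n, n) (s0 n).
have [x _ qx] : range q l by rewrite qsurj.
(* The next centre is farther than twice its radius from [q x], because [x] has norm at most this
   index; yet the limit [l = q x] is within twice that radius. *)
have [_ _ _ h] := fP (s (Num.truncn (rnorm x)).+1, (Num.truncn (rnorm x)).+1) (s0 _).
have := h x (ltW (truncnS_gt _)); rewrite qx ltNge.
by rewrite rnorm_sub (lP (Num.truncn (rnorm x)).+2).
Qed.

(** The open mapping theorem in quantitative form. Differences move almost openness from [z0] to 0,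
    which doubles the norm bound; the residual error is then lifted again and again, halving each
    time. *)
Lemma bounded_lift (V W : completeNormedModType K) (q : {linear V -> W}) :
  bounded_op q -> range q = setT ->
  exists2 c, 0 <= c & forall z, exists2 x, q x = z & rnorm x <= c * rnorm z.
Proof.
move=> /(bounded_opP sc)[B B0 qB] qsurj.
have [z0 [r [n [r0 near_z0]]]] := surjective_almost_open qsurj.
have near0 z d : rnorm z <= r -> 0 < d ->
    exists2 x, rnorm x <= 2 * n%:R & rnorm (z - q x) <= d.
  move=> zr d0; have d20 : 0 < d / 2 by rewrite divr_gt0.
  have [|x xn xd] := near_z0 (z + z0) _ _ d20; first by rewrite addrK.
  have [|y yn yd] := near_z0 z0 _ _ d20; first by rewrite subrr rnorm0 ltW.
  exists (x - y); first by have := rnormD sc x (- y); rewrite rnormN; lra.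
  have -> : z - q (x - y) = (z + z0 - q x) + - (z0 - q y).
    by rewrite linearB !opprB [z + z0 - _]addrAC addrACA subrr addr0 [q y - _]addrC addrA.
  by rewrite (le_trans (rnormD _ _ _)) // rnormN; lra.
(* Rescaled to norm [r], a vector is hit up to [r / 2] from the ball of radius [2 * n%:R]; [C]
   undoes the scaling. *)
pose C := 2 * n%:R / r.
have C0 : 0 <= C by rewrite divr_ge0 ?mulr_ge0 // ltW.
have /choice[g gP] z : exists x, rnorm x <= C * rnorm z /\
    rnorm (z - q x) <= rnorm z / 2.
  have [z_le|z_gt] := leP (rnorm z) 0.
    exists 0; rewrite (rnorm_eq0 z_le) linear0 subr0 !rnorm0 mulr0 mul0r.
    by split.
  have a0 : 0 < r / rnorm z by exact: divr_gt0.
  have [||x xn xd] := near0 (iota (r / rnorm z) *: z) (r / 2).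
  - by rewrite rnormZ rabs_iota gtr0_norm // divfK ?gt_eqF.
  - exact: divr_gt0.
  exists (iota (r / rnorm z)^-1 *: x); split.
    rewrite rnormZ rabs_iota gtr0_norm ?invr_gt0 // ler_pdivrMl //.
    have -> : r / rnorm z * (C * rnorm z) = 2 * n%:R.
      by rewrite /C; field; rewrite !gt_eqF.
    by [].
  have -> : z - q (iota (r / rnorm z)^-1 *: x) =
      iota (r / rnorm z)^-1 *: (iota (r / rnorm z) *: z - q x).
    by rewrite linearZ scalerBr scalerA -rmorphM mulVf ?gt_eqF // rmorph1 scale1r.
  rewrite rnormZ rabs_iota gtr0_norm ?invr_gt0 // ler_pdivrMl //.
  have -> : r / rnorm z * (rnorm z / 2) = r / 2 by field; rewrite gt_eqF.
  by [].
exists (2 * C) => [|z]; first exact: mulr_ge0.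
pose w := fix w k := if k is m.+1 then w m - q (g (w m)) else z.
pose s := fix s k := if k is m.+1 then s m + g (w m) else 0.
have w_le k : rnorm (w k.+1) <= rnorm (w k) / 2 by have [] := gP (w k).
have ws k : w k = z - q (s k).
  elim: k => [|k IH] /=; first by rewrite linear0 subr0.
  by rewrite IH linearD opprD addrA -IH.
have [||l lP] := @geometric_limit V s (fun k => C * rnorm (w k)).
- by move=> k /=; rewrite addrC addKr; have [] := gP (w k).
- by move=> k; rewrite -[leRHS]mulrA ler_wpM2l.
exists l; last by have := lP 0%N; rewrite /= subr0 mulrA.
have w_half k : rnorm (w k) <= rnorm z * 2^-1 ^+ k.
  elim: k => [|k IH]; first by rewrite expr0 mulr1.
  by rewrite exprS; have := w_le k; lra.
apply/eqP; rewrite -subr_eq0; apply/eqP/(@rnorm_eq0 _ _ sc).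
apply/ler_addgt0Pr => e e0; rewrite add0r.
have [k kP] := half_exp_small ((B * (2 * C) + 1) * rnorm z) e0.
have -> : q l - z = q (l - s k) - w k.
  by rewrite ws linearB opprB addrA subrK.
rewrite (le_trans (rnormD _ _ _)) // rnormN.
rewrite (le_trans _ kP) // -mulrA mulrDl mul1r lerD //.
rewrite (le_trans (qB _)) // -[leRHS]mulrA ler_wpM2l // (le_trans (lP k)) //.
by rewrite -[leRHS]mulrA !ler_wpM2l.
Qed.

End OpenMapping.

(** * Coordinates on subspaces of an L_infinity space *)

Section LinftyCoordinates.
Context {R : realType} {K : numFieldType} (sc : scalars R K).
Local Notation iota := (iota sc).
Local Notation re := (re sc).
Local Notation rabs := (rabs sc).
Local Notation rnorm := (rnorm sc).

(** [supremum] is meaningful only once a least upper bound in [K] is exhibited; it is transported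
    from [R]. Homogeneity on [E] is asked instead of a bundled linear map because the inverse in
    [banach_mazur] is a plain function. *)
Lemma opnorm_onP (V W : normedModType K) (E : set V) (f : V -> W) :
  E 0 -> f 0 = 0 ->
  (forall a x, E x -> E (a *: x) /\ f (a *: x) = a *: f x) -> bounded_on E f ->
  0 <= opnorm_on E f /\ forall x, E x -> rnorm (f x) <= re (opnorm_on E f) * rnorm x.
Proof.
move=> E0 f0 fZ /(bounded_onP sc)[M M0 fM].
pose A := [set `|f x| | x in E `&` [set x | `|x| <= 1]].
pose B := [set rnorm (f x) | x in E `&` [set x | rnorm x <= 1]].
have B0 : B 0 by exists 0; rewrite ?f0 ?rnorm0 //; split=> //=; rewrite rnorm0.
have hB : has_sup B.
  split; first by exists 0.
  exists M => _ [x [Ex /= x1] <-]; rewrite (le_trans (fM _ Ex)) //.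
  by rewrite ler_piMr.
have AB a : A a <-> exists2 b, B b & a = iota b.
  split=> [[x [Ex /= x1] <-]|[_ [x [Ex x1] <-] ->]].
    exists (rnorm (f x)); last exact: (rnormE sc).
    by exists x => //; split=> //=; rewrite rnorm_le rmorph1.
  exists x; last exact: (rnormE sc).
  by split=> //=; rewrite -(rmorph1 iota) -rnorm_le.
have supA : supremums A (iota (sup B)).
  split=> [a /AB[b Bb ->]|u uA].
    by rewrite iota_le; apply: ub_le_sup => //; exact: hB.2.
  have u0 : 0 <= u by apply: uA; apply/AB; exists 0; rewrite ?rmorph0.
  rewrite -(reE sc u0) iota_le; apply: ge_sup; first exact: hB.1.
  by move=> b Bb; rewrite -(iota_le sc) reE //; apply: uA; apply/AB; exists b.
have opE : opnorm_on E f = iota (sup B).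
  rewrite /opnorm_on /supremum -/A ifF; last first.
    apply/negP => /eqP A0; suff : A 0 by rewrite A0.
    by apply/AB; exists 0; rewrite ?rmorph0.
  by case: xgetP => [y _ yA|/(_ _ supA)//]; exact: (is_subset1_supremums yA supA).
have sup0 : 0 <= sup B by apply: ub_le_sup => //; exact: hB.2.
rewrite opE iota_ge0 re_iota; split=> // x Ex.
have [x_le|x_gt] := leP (rnorm x) 0.
  by rewrite (rnorm_eq0 x_le) f0 !rnorm0 mulr0.
have [Ex' fx'] := fZ (iota (rnorm x)^-1) x Ex.
have : rnorm (f (iota (rnorm x)^-1 *: x)) <= sup B.
  apply: ub_le_sup; first exact: hB.2.
  exists (iota (rnorm x)^-1 *: x) => //; split=> //=.
  by rewrite rnormZ rabs_iota gtr0_norm ?invr_gt0 // mulVf ?gt_eqF.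
by rewrite fx' rnormZ rabs_iota gtr0_norm ?invr_gt0 // ler_pdivrMl // mulrC.
Qed.

(** As in the case of suprema, the infimum is computed on real parts. It need not be attained,
    whence the 1. *)
Lemma infimum_approx (D : set K) (lam : K) :
  D !=set0 -> (forall d, D d -> 0 <= d) -> infimum 0 D <= lam ->
  exists2 d, D d & re d <= rabs lam + 1.
Proof.
move=> [d0 Dd0] Dge Dlam.
pose B := [set re d | d in D].
have hB : has_inf B.
  by split; [exists (re d0), d0|exists 0 => _ [d Dd <-]; apply: re_ge0; exact: Dge].
have infD : infimums D (iota (inf B)).
  split=> [d Dd|b bD].
    by rewrite -(reE sc (Dge _ Dd)) iota_le; apply: ge_inf; [exact: hB.2|exists d].
  (* A lower bound in [K] is real because it lies below the real element [d0]. *)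
  have bE : b = iota (re b).
    have : 0 <= d0 - b by rewrite subr_ge0; exact: bD.
    move=> /(reE sc) h; suff [c ->] : exists c, b = iota c by rewrite re_iota.
    by exists (re d0 - re (d0 - b)); rewrite rmorphB /= h reE ?Dge //; ring.
  rewrite bE iota_le; apply: lb_le_inf; first exact: hB.1.
  by move=> _ [d Dd <-]; rewrite -(iota_le sc) -bE reE ?Dge //; exact: bD.
have infE : infimum 0 D = iota (inf B).
  rewrite /infimum ifF; last by apply/negP => /eqP D0; rewrite D0 in Dd0.
  by case: xgetP => [y _ yA|/(_ _ infD)//]; exact: (is_subset1_infimums yA infD).
have [_ [d Dd <-] dlt] := inf_adherent (@ltr01 R) hB.
exists d => //; rewrite (le_trans (ltW dlt)) // lerD2r -(iota_le sc) -infE -rabsE.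
rewrite (le_trans Dlam) // ger0_norm // (le_trans _ Dlam) // infE iota_ge0.
by apply: lb_le_inf; [exact: hB.1|move=> _ [c Dc <-]; apply: re_ge0; exact: Dge].
Qed.

Lemma Linfty_fd_iso (Y : normedModType K) : Linfty_space Y ->
  exists lam : R, forall E : set Y, finite_dim_subspace E ->
    exists n (S : {linear 'rV[K]_n -> Y}) t r,
      [/\ fd_iso sc S t r, r * t <= lam & forall x, E x -> exists a, x = S a].
Proof.
move=> [lam lamP]; exists (rabs lam + 1) => E /lamP[n [F [[v [hv FE]] EF bm]]].
have opST (S : {linear 'rV[K]_n -> Y}) (T : Y -> 'rV[K]_n) :
    bounded_op S -> range S = F -> cancel S T -> bounded_on F T ->
    [/\ 0 <= opnorm_on setT S, 0 <= opnorm_on F T,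
        forall a, rnorm (S a) <= re (opnorm_on setT S) * rnorm a &
        forall a, rnorm a <= re (opnorm_on F T) * rnorm (S a)].
  move=> Sb SF ST Tb.
  have [//|||S0 SP] := opnorm_onP (E := setT) (f := S) _ _ _ Sb.
  - exact: linear0.
  - by move=> a x _; rewrite linearZ.
  have [|||T0 TP] := opnorm_onP (E := F) (f := T) _ _ _ Tb.
  - by rewrite -SF; exists 0; rewrite ?linear0.
  - by rewrite -(linear0 S) ST.
  - by move=> a x; rewrite -SF => -[b _ <-]; rewrite -linearZ !ST; split.
  split=> // a; first exact: SP.
  by rewrite -{1}(ST a) TP // -SF; exists a.
have [|d|d [S [T [Sb SF ST Tb ->]]] dlam] := infimum_approx _ _ bm.
(* A basis of [F] gives one isomorphism, so the infimum is not taken over the empty set, where it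
   would default to 0. *)
- have [S [t [r [[t0 r0 tS rS] SE]]]] := lin_indep_fd_iso sc hv.
  have Sinj := fd_iso_inj (And4 t0 r0 tS rS).
  have /choice[T TP] y : exists a, forall b, y = S b -> a = b.
    have [[b yb]|nb] := pselect (exists b, y = S b).
      by exists b => b'; rewrite yb; exact: Sinj.
    by exists 0 => b yb; case: nb; exists b.
  have ST : cancel S T by move=> a; apply: TP.
  have SF : range S = F.
    rewrite FE; apply/seteqP; split=> [_ [a _ <-]|_ [a ->]].
      by exists (fun i => a 0 i); rewrite SE.
    exists (\row_i a i) => //; rewrite SE; apply: eq_bigr => i _.
    by rewrite mxE.
  eexists; exists S, T; split=> //.
    apply/(bounded_opP sc); exists r => // a; apply: rS; first exact: rnorm_ge0.
    by move=> i; rewrite -(iota_le sc) -rabsE -rnormE le_mx_norm.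
  apply/(bounded_onP sc); exists t => // y; rewrite -SF => -[a _ <-].
  rewrite ST rnorm_le; apply: mx_norm_le; first by rewrite iota_ge0 mulr_ge0 ?rnorm_ge0.
  by move=> i k; rewrite ord1 (rabsE sc) iota_le.
- move=> [S [T [Sb SF ST Tb ->]]].
  by have [? ? _ _] := opST S T Sb SF ST Tb; exact: mulr_ge0.
have [S0 T0 SP TP] := opST S T Sb SF ST Tb.
exists n, S, (re (opnorm_on F T)), (re (opnorm_on setT S)); split.
- split; rewrite ?re_ge0 //.
  + move=> a i; rewrite (le_trans _ (TP a)) // -(iota_le sc) -rabsE -rnormE.
    exact: le_mx_norm.
  + move=> a M M0 aM; rewrite (le_trans (SP a)) // ler_wpM2l ?re_ge0 //.
    rewrite rnorm_le; apply: mx_norm_le; rewrite ?iota_ge0 // => i k.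
    by rewrite ord1 (rabsE sc) iota_le.
- by rewrite -(reM sc) reE.
- by move=> x /EF; rewrite -SF => -[a _ <-]; exists a.
Qed.

End LinftyCoordinates.

(** * Approximating the identity on a subspace *)

Section BoundedOps.
Context {R : realType} {K : numFieldType} (sc : scalars R K).
Local Notation rnorm := (rnorm sc).
Implicit Types U V W : normedModType K.

Lemma bounded_opD V W (f g : V -> W) :
  bounded_op f -> bounded_op g -> bounded_op (fun x => f x + g x).
Proof.
move=> /(bounded_opP sc)[M M0 fM] /(bounded_opP sc)[N N0 gN].
apply/(bounded_opP sc); exists (M + N) => [|x]; first exact: addr_ge0.
by rewrite mulrDl (le_trans (rnormD _ _ _)) // lerD.
Qed.

Lemma bounded_op_comp U V W (f : V -> W) (g : U -> V) :
  bounded_op f -> bounded_op g -> bounded_op (fun x => f (g x)).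
Proof.
move=> /(bounded_opP sc)[M M0 fM] /(bounded_opP sc)[N N0 gN].
apply/(bounded_opP sc); exists (M * N) => [|x]; first exact: mulr_ge0.
by rewrite (le_trans (fM _)) // -mulrA ler_wpM2l.
Qed.

Lemma bounded_opN V W (f : V -> W) : bounded_op f -> bounded_op (fun x => - f x).
Proof.
by move=> [M fM]; exists M => x Ex; rewrite normrN; exact: fM.
Qed.

Lemma bounded_op_id V : bounded_op (id : V -> V).
Proof. by exists 1 => x _; rewrite mul1r. Qed.

Lemma bounded_op_sub V W (f g : V -> W) :
  bounded_op f -> bounded_op g -> bounded_op (fun x => f x - g x).
Proof. by move=> hf hg; apply: bounded_opD => //; exact: bounded_opN. Qed.

Lemma finite_rank_spanned V W (f : {linear V -> W}) :
  finite_rank f -> spanned_range f.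
Proof.
move=> [n [v [_ fE]]]; exists n, v => x; rewrite -fE.
by exists x.
Qed.

Lemma thickening_le (Y X : normedModType K) (j : Y -> X) C d d' y : d <= d' ->
  thickening sc j C d y -> thickening sc j C d' y.
Proof. by move=> dd' [x Cx xy]; exists x => //; exact: le_trans dd'. Qed.

End BoundedOps.

Section PairApproximation.
Context {R : realType} {K : numFieldType} (sc : scalars R K).
Local Notation iota := (iota sc).
Local Notation rabs := (rabs sc).
Local Notation rnorm := (rnorm sc).
Context (Y X : normedModType K) (j : {linear Y -> X}) (c lam : R).
Context (c_gt0 : 0 < c) (jc : forall y, c * rnorm y <= rnorm (j y)).
Context (lamP : forall E : set Y, finite_dim_subspace E ->
  exists n (S : {linear 'rV[K]_n -> Y}) t r,
    [/\ fd_iso sc S t r, r * t <= lam & forall x, E x -> exists a, x = S a]).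

Lemma lam_ge0 : 0 <= lam.
Proof.
have [n [v _]] := @lin_span_seq K Y [::].
have [m [S [t [r [[t0 r0 _ _] rt _]]]]] := lamP (lin_span_finite_dim v).
by rewrite (le_trans _ rt) // mulr_ge0.
Qed.

(** The identity of a finite dimensional subspace containing a net of the thickening extends to [w]
    with norm at most [lam], so [w - id] is at most [lam + 1] times the distance to the net. That
    distance is at most [4 * d / c]: radius [2 * d] for centres in [X], doubled by recentring, and
    [c] to return to the norm of [Y]. *)
Lemma approx_id_on_thickening (C : set X) d : totally_bounded sc C -> 0 < d ->
  exists w : {linear Y -> Y}, [/\ spanned_range w,
    forall y, rnorm (w y) <= lam * rnorm y &
    forall y, thickening sc j C d y -> rnorm (w y - y) <= (lam + 1) * 4 / c * d].
Proof.
move=> hC d0; have [l lP] := hC _ d0.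
have [|m [_ mP]] := @recenter_cover _ _ sc _ _ j (thickening sc j C d) l (2 * d).
  move=> y [x /lP[z zl xz] xy]; exists z => //.
  by have := rnormD sc (j y - x) (x - z); rewrite addrA subrK; lra.
have [n [v vm]] := lin_span_seq m.
have [k [S [t [r [hS rt Sv]]]]] := lamP (lin_span_finite_dim v).
have hn : seminorm sc (fun x : Y => rnorm x).
  by split=> [x y|a x]; [exact: rnormD|rewrite rnormZ].
have [|//|w [wS w_le wr]] := @extend_fd _ _ sc Y k S t r Y _ S S _ hS hn.
  by move=> u; exists u.
have w_lam y : rnorm (w y) <= lam * rnorm y.
  by rewrite (le_trans (w_le _)) // ler_wpM2r // rnorm_ge0.
exists w; split=> // [|y /mP[z zm yz]]; first exact: spanned_range_row wr.
have wz : w z = z by have [a ->] := Sv z (vm _ zm); rewrite wS.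
have -> : w y - y = w (y - z) + (z - y).
  by rewrite linearB wz addrA subrK.
rewrite (le_trans (rnormD _ _ _)) // (rnorm_sub _ z).
have yz_le : rnorm (y - z) <= 4 * d / c.
  rewrite ler_pdivlMr // mulrC (le_trans (jc _)) // linearB.
  by rewrite (le_trans yz) // mulrA; lra.
have := w_lam (y - z); have := ler_wpM2l lam_ge0 yz_le.
have -> : (lam + 1) * 4 / c * d = lam * (4 * d / c) + 4 * d / c by ring.
by lra.
Qed.

(** The range of [v] lies in a copy of l_infinity^k of distortion at most [lam], so the loss is the
    same for all [v]. *)
Lemma extend_into_Linfty (C : set X) rho (v : {linear Y -> Y}) d eta :
  abs_convex sc C -> (forall x, C x -> rnorm x <= rho) -> bounded_op v ->
  spanned_range v -> 0 < d -> 0 <= eta ->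
  (forall y, thickening sc j C d y -> rnorm (v y) <= eta) ->
  exists V : {linear X -> Y}, [/\ forall y, V (j y) = v y,
    forall x, C x -> rnorm (V x) <= lam * eta, bounded_op V & spanned_range V].
Proof.
move=> hC Crho /(bounded_opP sc)[B B0 vB] [n [u uv]] d0 eta0 v_eta.
have [k [S [t [r [hS rt Su]]]]] := lamP (lin_span_finite_dim u).
have vS y : exists a, v y = S a by apply: Su.
have [V [Vj VC [M VM] VS]] :=
  extend_small hS c_gt0 jc hC Crho B0 vB vS d0 eta0 v_eta.
exists V; split=> // [x Cx||].
- by rewrite (le_trans (VC _ Cx)) // ler_wpM2r.
- apply/(bounded_opP sc); exists `|M| => // x.
  by rewrite (le_trans (VM x)) // ler_wpM2r ?rnorm_ge0 // ler_norm.
- exact: spanned_range_row VS.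
Qed.

(* Extending the increments of the approximations of the identity of [Y], rather than
   the approximations themselves, keeps [D n @` C] inside one totally bounded set. *)
Lemma extended_approximations (C : set X) : abs_convex sc C -> totally_bounded sc C ->
  exists (D : nat -> {linear X -> Y}) (w : nat -> {linear Y -> Y}) (a kappa : R),
    [/\ forall n y, D n (j y) = w n y,
        forall n x, C x -> rnorm (D n.+1 x - D n x) <= a * 2^-1 ^+ n,
        forall n, bounded_op (D n) /\ spanned_range (D n),
        forall n, bounded_op (w n) & 0 <= kappa /\
        forall n y, thickening sc j C (2^-1 ^+ n) y ->
          rnorm (w n y - y) <= kappa * 2^-1 ^+ n].
Proof.
move=> hC tC; have [rho Crho] := tb_bounded tC.
have h0 n : 0 < 2^-1 ^+ n :> R by rewrite exprn_gt0 // invr_gt0.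
have /choice[w wP] n := approx_id_on_thickening tC (h0 n).
pose kappa := (lam + 1) * 4 / c.
have kappa0 : 0 <= kappa by rewrite divr_ge0 ?mulr_ge0 ?addr_ge0 ?lam_ge0 // ltW.
have wb n : bounded_op (w n).
  by apply/(bounded_opP sc); exists lam; [exact: lam_ge0|have [] := wP n].
have /choice[V VP] n : exists V : {linear X -> Y},
    [/\ forall y, V (j y) = w n.+1 y - w n y,
        forall x, C x -> rnorm (V x) <= lam * (2 * kappa * 2^-1 ^+ n),
        bounded_op V & spanned_range V].
  have [|v vE] := @linear_pack K Y Y (fun y => w n.+1 y - w n y).
    by move=> b x y; rewrite (linearP (w n.+1)) (linearP (w n)) scalerBr opprD addrACA.
  have vE' : (v : Y -> Y) = fun y => w n.+1 y - w n y by apply/funext.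
  have [wr _ wn] := wP n; have [wr' _ wn'] := wP n.+1.
  (* On the smaller thickening, of radius [2^-(n+1)], both [w n] and [w n.+1] are close to the
     identity, and the two errors add up to at most [2 * kappa * 2^-n]. *)
  have [|||y hy|V [Vj VC Vb Vs]] := @extend_into_Linfty C rho v _ (2 * kappa * 2^-1 ^+ n)
      hC Crho _ _ (h0 n.+1).
  - by rewrite vE'; exact: (bounded_op_sub sc).
  - rewrite vE'; apply: spanned_rangeD => //.
    have [m [u uw]] := wr; exists m, u => y; have := lin_spanP (-1) (uw y) (lin_span0 u).
    by rewrite scaleN1r addr0.
  - by rewrite mulr_ge0 ?(ltW (h0 _)) // mulr_ge0.
  - have hd : 2^-1 ^+ n.+1 <= 2^-1 ^+ n :> R by rewrite half_exp_le.
    have h1 := wn _ (thickening_le hd hy); have h2 := wn' _ hy.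
    rewrite vE; have := rnormD sc (w n.+1 y - y) (y - w n y); rewrite addrA subrK.
    rewrite (rnorm_sub _ y) -/kappa => h.
    have := ler_wpM2l kappa0 hd; rewrite -/kappa in h1 h2; lra.
  - by exists V; split=> // y; rewrite Vj vE.
(* The initial term may be any extension of [w 0]; no smallness is asked, and the bound on the
   thickening of radius 1 is the trivial one. *)
have [wr0 w0b _] := wP 0%N.
have [|y [x Cx xy]|D0 [D0j D0C D0b D0s]] := @extend_into_Linfty C rho (w 0%N) 1
    (lam * ((rho + 1) / c)) hC Crho (wb _) wr0 ltr01.
- have rho0 : 0 <= rho by apply: le_trans (rnorm_ge0 sc 0) (Crho _ _); case: hC.
  by rewrite mulr_ge0 ?lam_ge0 // divr_ge0 ?addr_ge0 // ltW.
- rewrite (le_trans (w0b y)) // ler_wpM2l ?lam_ge0 // ler_pdivlMr // mulrC.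
  rewrite (le_trans (jc _)) //; have := rnormD sc (j y - x) x; rewrite subrK.
  by have := Crho _ Cx; lra.
have /choice[D DE] n : exists D : {linear X -> Y},
    forall x, D x = D0 x + \sum_(i < n) V i x.
  apply: linear_pack => b x y; rewrite linearP scalerDr addrACA; congr (_ + _).
  rewrite scaler_sumr -big_split; apply: eq_bigr => i _; exact: linearP.
have DS n x : D n.+1 x = D n x + V n x by rewrite !DE big_ord_recr addrA.
exists D, w, (lam * (2 * kappa)), kappa; split=> //.
- elim=> [|n IH] y; first by rewrite DE big_ord0 addr0.
  by rewrite DS IH; have [-> _ _ _] := VP n; rewrite addrC subrK.
- by move=> n x Cx; rewrite DS addrC addKr -mulrA; have [_ + _ _] := VP n; apply.
- elim=> [|n [IHb IHs]].
    have -> : (D 0%N : X -> Y) = D0 by apply/funext => x; rewrite DE big_ord0 addr0.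
    by [].
  have -> : (D n.+1 : X -> Y) = fun x => D n x + V n x by apply/funext => x; exact: DS.
  have [_ _ Vb Vs] := VP n.
  by split; [exact: (bounded_opD sc)|exact: spanned_rangeD].
- by split=> // n y; have [_ _] := wP n; apply.
Qed.

End PairApproximation.

(** * Operators leaving the subspace invariant *)

Section PairAP.
Context {R : realType} {K : numFieldType} (sc : scalars R K).
Local Notation iota := (iota sc).
Local Notation rnorm := (rnorm sc).

(** Up to [e], the images of [C] under late [D n] lie in the image under [D N], which leaves
    finitely many images. *)
Lemma tb_increments (X : normedModType K) (C : set X) (D : nat -> {linear X -> X}) a :
  totally_bounded sc C -> (forall n, bounded_op (D n)) ->
  (forall n x, C x -> rnorm (D n.+1 x - D n x) <= a * 2^-1 ^+ n) ->
  totally_bounded sc [set z | exists n x, C x /\ z = D n x].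
Proof.
move=> hC Db Da; apply: tb_approx => e e0.
have [N Ne] := half_exp_small (2 * a) e0.
exists [set z | exists2 n, (n <= N)%N & (D n @` C) z]; split.
  apply: tb_finite_union => n; have /(bounded_opP sc)[M _ DM] := Db n.
  exact: tb_image DM hC.
move=> _ [n [x [Cx ->]]]; have [nN|Nn] := leqP n N.
  exists (D n x); last by rewrite subrr rnorm0 ltW.
  by exists n => //; exists x.
exists (D N x); first by exists N => //; exists x.
have a0 : 0 <= a.
  by have := le_trans (rnorm_ge0 _ _) (Da 0%N x Cx); rewrite expr0 mulr1.
suff h k : rnorm (D (N + k)%N x - D N x) <= 2 * a * (2^-1 ^+ N - 2^-1 ^+ (N + k)).
  rewrite -(subnKC (ltnW Nn)) (le_trans (h _)) // (le_trans _ Ne) //.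
  rewrite ler_wpM2l ?mulr_ge0 // gerBl exprn_ge0 // invr_ge0.
elim: k => [|k IH]; first by rewrite addn0 !subrr rnorm0 mulr0.
rewrite addnS; have := rnormD sc (D (N + k).+1 x - D (N + k)%N x) (D (N + k)%N x - D N x).
by rewrite addrA subrK exprS; have := Da (N + k)%N x Cx; lra.
Qed.

(** The working form of [id_tau_limit]: total boundedness, unlike compactness, survives absolutely
    convex hulls. *)
Definition approximable (X : normedModType K) (P : set {linear X -> X}) :=
  forall A e, totally_bounded sc A -> 0 < e ->
    exists2 T, P T & forall x, A x -> rnorm (T x - x) <= e.

Lemma id_tau_limit_approximable (X : normedModType K) (P : set {linear X -> X}) :
  (forall T, P T -> bounded_op T) -> id_tau_limit P -> approximable P.
Proof.
move=> Pb hP A e hA e0; have [N hN NA] := tb_null_set hA.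
have e20 : 0 < e / 2 by rewrite divr_gt0.
have [T PT TN] := id_tau_limit_approx sc hP (null_set_compact hN) e20.
exists T => // x Ax.
have [|F FE] := @linear_pack K X X (fun x => T x - x).
  by move=> b u v; rewrite linearP scalerBr opprD addrACA.
have /(bounded_opP sc)[M _ FM] : bounded_op (fun x => T x - x).
  by apply: (bounded_op_sub sc); [exact: Pb|exact: bounded_op_id].
have := NA X F M (e / 2); rewrite [2 * _]mulrC divfK // -FE => h.
apply: h => // [v|v Nv]; rewrite FE; first exact: FM.
by apply: TN; right.
Qed.

Lemma pair_approximable (Y X : normedModType K) (j : {linear Y -> X}) :
  isomorphic_embedding j -> AP X -> Linfty_space Y ->
  approximable [set T : {linear X -> X} |
    [/\ bounded_op T, finite_rank T & T @` range j `<=` range j]].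
Proof.
move=> [jb [c0 c0_gt0 jc0]] hX /(Linfty_fd_iso sc)[lam lamP] A e hA e0.
have c_gt0 := re_gt0 sc c0_gt0.
have jc y : re sc c0 * rnorm y <= rnorm (j y).
  by rewrite -(iota_le sc) rmorphM /= -!rnormE reE // ltW.
pose C := abs_convex_hull sc A.
have hC : abs_convex sc C by exact: abs_convex_hullP.
have tC : totally_bounded sc C by exact: tb_abs_convex_hull.
have [D [w [a [kappa [Dj Da Dbs wb [kappa0 wk]]]]]] :=
  extended_approximations c_gt0 jc lamP hC tC.
have /(bounded_opP sc)[B B0 jB] := jb.
have /choice[E EE] n : exists E : {linear X -> X}, forall x, E x = x - j (D n x).
  apply: linear_pack => b x y.
  by rewrite (linearP (D n)) (linearP j) scalerBr opprD addrACA.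
have Eb n : bounded_op (E n).
  have -> : (E n : X -> X) = fun x => x - j (D n x) by apply/funext.
  apply: (bounded_op_sub sc); first exact: bounded_op_id.
  by apply: (bounded_op_comp sc) => //; case: (Dbs n).
have tE : totally_bounded sc [set z | exists n x, C x /\ z = E n x].
  apply: (tb_increments tC Eb (a := B * a)) => n x Cx.
  have -> : E n.+1 x - E n x = - j (D n.+1 x - D n x).
    by rewrite !EE (linearB j) !opprB addrC addrA subrK.
  by rewrite rnormN (le_trans (jB _)) // -mulrA ler_wpM2l // Da.
have e20 : 0 < e / 2 by rewrite divr_gt0.
have hX' : approximable [set T : {linear X -> X} | bounded_op T /\ finite_rank T].
  by apply: id_tau_limit_approximable hX => T [].
have [S [Sb [m [u [u_indep Su]]]] SE] := hX' _ _ tE e20.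
have [S0 [t [r [hS0 S0E]]]] := lin_indep_fd_iso sc u_indep.
have [t0 r0 _ _] := hS0.
have /(bounded_opP sc)[M M0 SM] := Sb.
(* The distortion [r * t] of the range of [S] and the bound [M] are known only now; the rate [2^-n]
   absorbs them. *)
have [n n_small] := half_exp_small (r * t * (M * B * kappa)) e20.
have [|v vE] := @linear_pack K Y X (fun y => S (j y - j (w n y))).
  move=> b x y; rewrite -(linearP S); congr (S _).
  by rewrite (linearP (w n)) !(linearP j) scalerBr opprD addrACA.
have /(bounded_opP sc)[Mv Mv0 vb] : bounded_op v.
  have -> : (v : Y -> X) = fun y => S (j y - j (w n y)) by apply/funext.
  apply: (bounded_op_comp sc) => //; apply: (bounded_op_sub sc) => //.
  exact: (bounded_op_comp sc).
have vS y : exists b, v y = S0 b.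
  have : range S (v y) by rewrite vE; exists (j y - j (w n y)).
  rewrite Su => -[b ->]; exists (\row_i b i); rewrite S0E.
  by apply: eq_bigr => i _; rewrite mxE.
have h0 k : 0 < 2^-1 ^+ k :> R by rewrite exprn_gt0 // invr_gt0.
have [rho Crho] := tb_bounded tC.
have [||V [Vj VC [Mb VM] VS0]] := extend_small hS0 c_gt0 jc hC Crho Mv0 vb vS (h0 n)
    (eta := M * B * kappa * 2^-1 ^+ n).
- by rewrite !mulr_ge0 // ltW.
- move=> y /wk h; rewrite vE (le_trans (SM _)) // -!mulrA ler_wpM2l // -linearB.
  by rewrite (le_trans (jB _)) // ler_wpM2l // rnorm_sub.
have Vb : bounded_op V.
  apply/(bounded_opP sc); exists `|Mb| => // x.
  by rewrite (le_trans (VM x)) // ler_wpM2r ?rnorm_ge0 // ler_norm.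
have [|T TE] := @linear_pack K X X (fun x => j (D n x) + (S (E n x) - V x)).
  move=> b x y; rewrite (linearP V) (linearP (E n)) (linearP S).
  rewrite (linearP (D n)) (linearP j).
  by rewrite scalerDr scalerBr opprD [X in _ + _ + X = _]addrACA [LHS]addrACA.
have TE' : (T : X -> X) = fun x => j (D n x) + (S (E n x) - V x) by apply/funext.
have [Db Ds] := Dbs n.
exists T; first split.
- rewrite TE'; apply: (bounded_opD sc); first exact: (bounded_op_comp sc).
  by apply: (bounded_op_sub sc) => //; exact: (bounded_op_comp sc).
- apply: spanned_range_finite_rank; rewrite TE'; apply: spanned_rangeD.
    exact: spanned_range_linear.
  apply: spanned_rangeD.
    apply: spanned_range_comp; exists m, u => x; rewrite -Su.
    by exists x.
  have [k [z zV]] := spanned_range_row VS0.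
  exists k, z => x; have := lin_spanP (-1) (zV x) (lin_span0 z).
  by rewrite scaleN1r addr0.
- move=> _ [_ [y _ <-] <-]; exists (w n y) => //.
  by rewrite TE EE Dj Vj vE subrr addr0.
- move=> x Ax; have Cx : C x by exact: sub_abs_convex_hull.
  have -> : T x - x = (S (E n x) - E n x) - V x.
    have xE : E n x + j (D n x) = x by rewrite EE subrK.
    rewrite TE -[X in _ - X = _]xE (addrC (E n x)) opprD addrA.
    by rewrite [j _ + _]addrC addrK addrAC.
  rewrite (le_trans (rnormD _ _ _)) // rnormN.
  have h1 : rnorm (S (E n x) - E n x) <= e / 2 by apply: SE; exists n, x.
  have h2 := VC _ Cx; rewrite mulrA in h2.
  by have := le_trans h2 n_small; lra.
Qed.

(** Invariance of the kernel makes [q (T (g z))] independent of the lift [g z], hence linear in [z]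
    although [g] is not. From [rnorm (g z) <= c * rnorm z] it follows that [g] maps null sets to
    null sets; for totally bounded sets this estimate says nothing, hence the passage through
    [N]. *)
Lemma quotient_approximable (X Z : completeNormedModType K) (q : {linear X -> Z}) :
  bounded_op q -> range q = setT ->
  approximable [set T : {linear X -> X} | [/\ bounded_op T, finite_rank T &
     T @` [set x | q x = 0] `<=` [set x | q x = 0]]] ->
  approximable [set T : {linear Z -> Z} | bounded_op T /\ finite_rank T].
Proof.
move=> qb qsurj hX A e hA e0.
have [c c_ge0 lift] := bounded_lift sc qb qsurj.
have /(bounded_opP sc)[B B0 qB] := qb.
have /choice[g gP] z : exists x, q x = z /\ rnorm x <= c * rnorm z.
  by have [x] := lift z; exists x.
have qg z : q (g z) = z by case: (gP z).
have gc z : rnorm (g z) <= c * rnorm z by case: (gP z).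
have [N hN NA] := tb_null_set hA.
have c1 : 0 < c + 1 by rewrite ltr_wpDl.
have hgN : null_set sc (g @` N).
  move=> d d0; have [l lP] := hN _ (divr_gt0 d0 c1).
  exists (map g l) => _ [z /lP[zl|zd] <-]; [left; exact: map_f|right].
  rewrite (le_trans (gc z)) // (@le_trans _ _ ((c + 1) * rnorm z)) //.
    by rewrite ler_wpM2r ?rnorm_ge0 // lerDl.
  by rewrite mulrC -ler_pdivlMr.
(* Applying [q] costs a factor [B], and [tb_null_set] a factor 2; adding 1 keeps the divisor
   positive. *)
have B1 : 0 < 2 * (B + 1) by rewrite mulr_gt0 // ltr_wpDl.
have [T [Tb Tr Tq] TgN] := hX _ _ (null_set_tb hgN) (divr_gt0 e0 B1).
have qT x x' : q x = q x' -> q (T x) = q (T x').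
  move=> xx'; apply/eqP; rewrite -subr_eq0 -!linearB; apply/eqP/Tq.
  by exists (x - x') => //=; rewrite linearB xx' subrr.
have [|U UE] := @linear_pack K Z Z (fun z => q (T (g z))).
  by move=> b y z; rewrite -!linearP; apply: qT; rewrite linearP !qg.
have UE' : (U : Z -> Z) = fun z => q (T (g z)) by apply/funext.
have Ub : bounded_op U.
  rewrite UE'; apply: (bounded_op_comp sc) => //; apply: (bounded_op_comp sc) => //.
  by apply/(bounded_opP sc); exists c.
exists U; first split=> //.
  apply: spanned_range_finite_rank; rewrite UE'; apply: spanned_range_linear.
  by apply: spanned_range_comp; exact: finite_rank_spanned.
have [|F FE] := @linear_pack K Z Z (fun x => U x - x).
  by move=> b u v; rewrite linearP scalerBr opprD addrACA.
have /(bounded_opP sc)[M _ FM] : bounded_op (fun x => U x - x).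
  by apply: (bounded_op_sub sc) => //; exact: bounded_op_id.
move=> z Az; have := NA Z F M (e / 2); rewrite [2 * _]mulrC divfK // -FE => h.
apply: h => // [v|v Nv]; rewrite FE; first exact: FM.
rewrite UE -{2}(qg v) -linearB (le_trans (qB _)) //.
have := TgN (g v); rewrite ler_pdivlMr // => h; have := h _; move=> {}h.
have {}h : rnorm (T (g v) - g v) * (2 * (B + 1)) <= e by apply: h; exists v.
by have := rnorm_ge0 sc (T (g v) - g v); lra.
Qed.

End PairAP.

Theorem corollary1 (R : realType) (K : numFieldType) (hK : scalar_field R K)
    (Y X Z : completeNormedModType K)
    (j : {linear Y -> X}) (q : {linear X -> Z})
    (hexact : short_exact_sequence j q)
    (hX : AP X) (hY : Linfty_space Y) :
  pair_AP (range j) /\ AP Z.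
Proof.
have [sc] := scalar_fieldP hK.
have [jemb qb qsurj jq] := hexact.
have hpair := pair_approximable (sc := sc) jemb hX hY.
split; apply: (approx_id_tau_limit (sc := sc)); first exact: hpair.
by apply: (quotient_approximable qb qsurj); rewrite -jq.
Qed.
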